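(* Let $k$ be an infinite field (of arbitrary characteristic). There is $t_0\in\{1,2\}$ such that, for all positive integers $r$ and $t$, the following holds: all level Hilbert functions (over $k$) of codimension $r$ and type $t$ are log-concave if and only if (1) $r\le 2$; or (2) $r=3$ and $t\le t_0$. Moreover, with the possible exception of the case $(r,t)=(3,2)$, this classification is independent of the characteristic of $k$; that is, for every pair $(r,t)\neq(3,2)$, whether all level Hilbert functions of codimension $r$ and type $t$ are log-concave does not depend on the characteristic of $k$.
   Context: Let $k$ be an infinite field. A standard graded artinian algebra of codimension $r$ over $k$ is a quotient $A=R/I$, where $R=k[x_1,\dots,x_r]$ is a polynomial ring with all $x_i$ of degree one, $I\subset R$ is a homogeneous ideal containing no nonzero linear forms, and $A$ is finite-dimensional over $k$. The Hilbert function of $A$ is $h_i=\dim_k A_i$ for $i\ge 0$; it is identified with the vector $h(A)=(1,h_1,\dots,h_e)$, where $e$ is the largest index with $h_e>0$, called the socle degree of $A$ (so $h_1=r$, and $h_i=0$ for $i>e$). The socle of $A$ is the annihilator in $A$ of the maximal homogeneous ideal $(\overline{x_1},\dots,\overline{x_r})$. The algebra $A$ is level if its socle is concentrated in the last degree $e$; in that case its type is $t=h_e$, the dimension over $k$ of the socle. A level Hilbert function (over $k$) of codimension $r$ and type $t$ is a sequence $h=(1,h_1=r,h_2,\dots,h_e=t)$ such that $h=h(A)$ for some level algebra $A$ over $k$. A sequence $(a_n)_{n\in\mathbb N}$ is log-concave if $a_{i-1}a_{i+1}\le a_i^2$ for all indices $i\geq 1$; a Hilbert function $(1,h_1,\dots,h_e)$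 is regarded as such a sequence with $h_i=0$ for $i>e$. *)

(* Defs.v *)
From HB Require Import structures.
From mathcomp Require Import all_boot all_order all_algebra.
From mathcomp Require Import generic_quotient ring_quotient mpoly.

Set Implicit Arguments.
Unset Strict Implicit.
Unset Printing Implicit Defensive.

Import GRing.Theory.
Local Open Scope ring_scope.
Local Open Scope quotient_scope.

(* The library makes R/I a commutative ring; for a commutative algebra R over
   k we add the induced k-algebra structure a *: \pi p = \pi (a *: p). *)
Section IdealQuotientAlgebra.
Variables (k : nzRingType) (R : comAlgType k) (I : idealr R).
Local Notation A := {ideal_quot I}.

Definition ideal_quot_scale (a : k) (u : A) : A := \pi_A (a%:A) * u.

Fact ideal_quot_scaleA a b u :
  ideal_quot_scale a (ideal_quot_scale b u) = ideal_quot_scale (a * b) u.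
Proof.
by rewrite /ideal_quot_scale mulrA -rmorphM /= -scalerAl mul1r scalerA.
Qed.

Fact ideal_quot_scale1 : left_id 1 ideal_quot_scale.
Proof. by move=> u; rewrite /ideal_quot_scale scale1r rmorph1 mul1r. Qed.

Fact ideal_quot_scaleDr : right_distributive ideal_quot_scale +%R.
Proof. by move=> a u v; rewrite /ideal_quot_scale mulrDr. Qed.

Fact ideal_quot_scaleDl u :
  {morph ideal_quot_scale^~ u : a b / a + b}.
Proof. by move=> a b; rewrite /ideal_quot_scale scalerDl rmorphD mulrDl. Qed.

HB.instance Definition _ := GRing.Zmodule_isLmodule.Build k {ideal_quot I}
  ideal_quot_scaleA ideal_quot_scale1 ideal_quot_scaleDr ideal_quot_scaleDl.

Fact ideal_quot_scaleAl (a : k) (u v : A) : a *: (u * v) = a *: u * v.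
Proof. exact: mulrA. Qed.

HB.instance Definition _ :=
  GRing.Lmodule_isLalgebra.Build k {ideal_quot I} ideal_quot_scaleAl.

HB.instance Definition _ :=
  GRing.Lalgebra_isComAlgebra.Build k {ideal_quot I}.

Lemma pi_scale (a : k) (p : R) : \pi_A (a *: p) = a *: \pi_A p.
Proof. by rewrite -[a *: p]mul1r -scalerAr scalerAl rmorphM. Qed.

End IdealQuotientAlgebra.

(* Intended for S a linear subspace of V: S has a basis with n elements.  With
   n as a relation rather than a function, it also says that S is
   finite-dimensional. *)
Definition has_dim (k : fieldType) (V : lmodType k) (S : V -> Prop) (n : nat) :
    Prop :=
  exists b : 'I_n -> V, (forall j, S (b j)) /\
    forall v, S v -> exists! c : {ffun 'I_n -> k}, v = \sum_j c j *: b j.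

Definition infinite_field (k : fieldType) : Prop :=
  forall s : seq k, exists x : k, x \notin s.

Section GradedAlgebra.
Variables (k : fieldType) (r : nat) (I : idealr {mpoly k[r]}).
Local Notation A := {ideal_quot I}.

Definition homogeneous_ideal : Prop :=
  forall p, p \in I -> forall d, pihomog mdeg d p \in I.

(* A = R/I is a standard graded artinian algebra of codimension r; the
   structure idealr already makes I a proper ideal. *)
Definition standard_graded_artinian : Prop :=
  [/\ homogeneous_ideal,
      (forall l : {mpoly k[r]}, l \is 1.-homog -> l \in I -> l = 0)
    & exists N : nat, has_dim (fun _ : A => True) N].

Definition component (i : nat) (a : A) : Prop :=
  exists2 p : {mpoly k[r]}, p \is i.-homog & a = \pi_A p.

Definition hilbert_function (h : nat -> nat) : Prop :=
  forall i, has_dim (component i) (h i).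

Definition max_ideal (m : A) : Prop :=
  exists c : 'I_r -> A, m = \sum_j c j * \pi_A 'X_j.

Definition socle (a : A) : Prop := forall m : A, max_ideal m -> m * a = 0.

Definition level (e : nat) : Prop := forall a, socle a -> component e a.

End GradedAlgebra.

Definition socle_degree (h : nat -> nat) (e : nat) : Prop :=
  (0 < h e)%N /\ forall i, (e < i)%N -> h i = 0%N.

(* h_1 = r is forced by the absence of linear forms in I. *)
Definition level_hilbert_function (k : fieldType) (r t : nat)
    (h : nat -> nat) : Prop :=
  exists I : idealr {mpoly k[r]},
    [/\ standard_graded_artinian I,
        hilbert_function I h
      & exists e : nat,
        [/\ socle_degree h e, level I e & h e = t]].

Definition log_concave (h : nat -> nat) : Prop :=
  forall i, (1 <= i)%N -> (h i.-1 * h i.+1 <= h i ^ 2)%N.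

Definition all_level_log_concave (k : fieldType) (r t : nat) : Prop :=
  forall h, level_hilbert_function k r t h -> log_concave h.

(* Main.v *)
(**
In codimension at most 2 the Koszul complex A_(i-1) -> A_i^2 -> A_(i+1) is
injective on the left when A is level and i <= e, so h is concave up to e + 1.

Let A be Gorenstein of codimension 3 and let d be the least degree of a nonzero
f in I.  Below d the function h is binomial.  Choose a point v with f(v) <> 0
and linear forms l, l' cutting out v; then A_i = l A_(i-1) + l' A_(i-1) for
i >= d, so that g_i = dim (A / lA)_i is nonincreasing for i >= d - 1.  By
duality h_i = h_(e-i), and multiplication by l has the same rank from A_(i-1)
to A_i as from A_(e-i) to A_(e-i+1).  For d - 1 <= i <= e / 2, adding the
inequalities g_(i+1) <= g_i and g_(e-i+1) <= g_(e-i) yields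
h_(i-1) + h_(i+1) <= 2 h_i, and symmetry takes care of i > e / 2.

For the counterexamples take t disjoint finite sets S_1, ..., S_t of points of
affine (r-1)-space and let the functional phi_i on forms of large degree e be
the sum of the values on S_i.  The largest ideal killed by all phi_i is level of
type t and h_(e-j) is the sum of the Hilbert functions of the S_i in degree j.
If S_1 contains a triangular plane grid with sides of length j + 1 and the other
n points of the S_i impose independent conditions already in degree j - 1, then
in degrees j - 1, j, j + 1 these values are n + C(j+1,2), n + C(j+2,2) and
n + C(j+3,2), and log-concavity fails as soon as n > C(j+2,2).
*)
From HB Require Import structures.
Require Import Defs.
From mathcomp Require Import all_boot all_order all_algebra.
From mathcomp Require Import generic_quotient ring_quotient mpoly.
From mathcomp Require Import zify ring.
From Stdlib Require Import Classical ClassicalEpsilon.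

Set Implicit Arguments.
Unset Strict Implicit.
Unset Printing Implicit Defensive.

Import GRing.Theory.

(** * Dimensions and coordinates *)

Section Bases.
Local Open Scope ring_scope.
Variables (k : fieldType) (V : lmodType k).

Definition combination n (b : 'I_n -> V) (c : 'rV[k]_n) : V :=
  \sum_j c 0 j *: b j.

Lemma combinationP n (b : 'I_n -> V) a c d :
  combination b (a *: c + d) = a *: combination b c + combination b d.
Proof.
rewrite /combination scaler_sumr -big_split; apply: eq_bigr => j _.
by rewrite !mxE scalerDl scalerA.
Qed.

Lemma combination0 n (b : 'I_n -> V) : combination b 0 = 0.
Proof. by rewrite /combination big1 // => j _; rewrite mxE scale0r. Qed.

Lemma combination_delta n (b : 'I_n -> V) j : combination b (delta_mx 0 j) = b j.
Proof.
rewrite /combination (bigD1 j) //= mxE !eqxx scale1r big1 ?addr0 // => l /negPf.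
by rewrite mxE => ->; rewrite scale0r.
Qed.

Lemma combination_sum n (b : 'I_n -> V) c :
  combination b c = \sum_j c 0 j *: combination b (delta_mx 0 j).
Proof. by apply: eq_bigr => j _; rewrite combination_delta. Qed.

Lemma combination_mul n m (b : 'I_n -> V) (c : 'rV_m) (M : 'M_(m, n)) :
  combination b (c *m M) = \sum_i c 0 i *: combination b (row i M).
Proof.
rewrite /combination; under [RHS]eq_bigr do rewrite scaler_sumr.
rewrite exchange_big; apply: eq_bigr => j _.
by rewrite mxE scaler_suml; apply: eq_bigr => i _; rewrite !mxE scalerA.
Qed.

(** [has_dim] alone does not make its set closed under linear combinations, so closure is carried
    separately. *)
Definition subspace (S : V -> Prop) : Prop :=
  S 0 /\ forall a u v, S u -> S v -> S (a *: u + v).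

Lemma subspace_combination S n (b : 'I_n -> V) c :
  subspace S -> (forall j, S (b j)) -> S (combination b c).
Proof.
by case=> S0 SD Sb; apply: big_ind => // [u v Su Sv|j _];
  [rewrite -[u]scale1r | rewrite -[_ *: _]addr0]; apply: SD.
Qed.

Lemma has_dim_coord S n : subspace S -> has_dim S n ->
  exists (b : 'I_n -> V) (crd : V -> 'rV[k]_n),
    [/\ forall c, S (combination b c),
        forall v, S v -> combination b (crd v) = v
      & forall c, crd (combination b c) = c].
Proof.
move=> subS [b [Sb bP]].
(* With the condition [S v] under the existential, choice yields a total coordinate function,
   arbitrary off [S]. *)
have ex v : exists c : 'rV[k]_n, S v -> combination b c = v.
  case: (classic (S v)) => [/bP [c [vE _]]|nSv]; last by exists 0.
  exists (\row_j c j) => _; rewrite vE; apply: eq_bigr => j _.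
  by rewrite mxE.
pose crd v := proj1_sig (constructive_indefinite_description _ (ex v)).
have crdP v : S v -> combination b (crd v) = v.
  exact: proj2_sig (constructive_indefinite_description _ (ex v)).
have Sc c : S (combination b c) by apply: subspace_combination.
exists b, crd; split=> // c; have [d [_ dU]] := bP _ (Sc c).
have Ec e : combination b e = combination b c -> d = [ffun j => e 0 j].
  by move=> Ee; apply: dU; rewrite -Ee; apply: eq_bigr => j _; rewrite ffunE.
apply/rowP=> j; have := Ec _ (crdP _ (Sc c)); rewrite (Ec c) //.
by move/ffunP/(_ j); rewrite !ffunE.
Qed.

Section ChosenBasis.
Variables (S : V -> Prop) (n : nat) (subS : subspace S) (Sn : has_dim S n).

Lemma chosen_basis_subproof : exists bc : ('I_n -> V) * (V -> 'rV[k]_n),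
  [/\ forall c, S (combination bc.1 c),
      forall v, S v -> combination bc.1 (bc.2 v) = v
    & forall c, bc.2 (combination bc.1 c) = c].
Proof. by have [b [crd ?]] := has_dim_coord subS Sn; exists (b, crd). Qed.

Let bc := constructive_indefinite_description _ chosen_basis_subproof.
Definition chosen_basis := (proj1_sig bc).1.
Definition chosen_coord := (proj1_sig bc).2.

Lemma chosen_basisS c : S (combination chosen_basis c).
Proof. by rewrite /chosen_basis; case: bc => x /= [+ _ _]; apply. Qed.

Lemma chosen_coordK v : S v -> combination chosen_basis (chosen_coord v) = v.
Proof. by rewrite /chosen_basis /chosen_coord; case: bc => x /= [_ + _]; apply. Qed.

Lemma chosen_basisK c : chosen_coord (combination chosen_basis c) = c.
Proof. by rewrite /chosen_basis /chosen_coord; case: bc => x /= [_ _ +]; apply. Qed.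

End ChosenBasis.

Definition independent (T : finType) (b : T -> V) : Prop :=
  forall c : T -> k, \sum_x c x *: b x = 0 -> forall x, c x = 0.

(** A relation between the coordinate rows of the [b x] is a relation between the [b x] themselves,
    so these rows form a row-free matrix with [m] columns. *)
Lemma card_independent_le S m (T : finType) (b : T -> V) :
  subspace S -> has_dim S m -> (forall x, S (b x)) -> independent b ->
  (#|T| <= m)%N.
Proof.
move=> subS Sm Sb ind.
pose C := \matrix_(i < #|T|) chosen_coord subS Sm (b (enum_val i)).
suff /eqP <- : row_free C by apply: rank_leq_col.
rewrite -kermx_eq0; apply/eqP/row_matrixP=> i; rewrite row0.
set c := row i _; have : c *m C = 0 by rewrite /c -row_mul mulmx_ker row0.
move/(congr1 (combination (chosen_basis subS Sm))).
rewrite combination0 combination_mul.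
under eq_bigr do rewrite rowK chosen_coordK //.
rewrite (reindex (@enum_rank T)) /=; last by apply: onW_bij; apply: enum_rank_bij.
under eq_bigr do rewrite enum_rankK.
move/(ind (fun x => c 0 (enum_rank x))) => c0; apply/rowP=> j.
by rewrite [RHS]mxE -[RHS](c0 (enum_val j)) enum_valK.
Qed.

Lemma has_dim_independent S n : has_dim S n -> subspace S ->
  exists2 b : 'I_n -> V, forall j, S (b j) & independent b.
Proof.
move=> Sn subS; have [b [crd [Sb crdK bK]]] := has_dim_coord subS Sn.
exists b => [j|c c0 j]; first by rewrite -combination_delta; apply: Sb.
have := bK (\row_j c j); rewrite (_ : combination _ _ = combination b 0).
  by rewrite bK => /rowP/(_ j); rewrite !mxE.
by rewrite combination0 -[RHS]c0; apply: eq_bigr => l _; rewrite mxE.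
Qed.

Lemma has_dim_le S n m : subspace S -> has_dim S n -> has_dim S m -> (n <= m)%N.
Proof.
move=> subS Sn Sm; have [b Sb ind] := has_dim_independent Sn subS.
by rewrite -[n]card_ord; apply: card_independent_le Sm Sb ind.
Qed.

Lemma has_dim_uniq S n m : subspace S -> has_dim S n -> has_dim S m -> n = m.
Proof. by move=> subS Sn Sm; apply/eqP; rewrite eqn_leq !(@has_dim_le S). Qed.

End Bases.

Lemma row_mul_inj (k : fieldType) m n (A B : 'M[k]_(m, n)) :
  (forall c : 'rV_m, c *m A = c *m B)%R -> A = B.
Proof. by move=> AB; apply/row_matrixP=> i; rewrite !rowE. Qed.

(** * Graded components of R/I *)

Section Components.
Local Open Scope ring_scope.

Lemma mpolyX_neq0 (k : fieldType) r (m : 'X_{1..r}) :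
  'X_[m] != 0 :> {mpoly k[r]}.
Proof. by rewrite -msupp_eq0 msuppX. Qed.

Lemma mnm_split n (m : 'X_{1..n}) : m <> 0%MM ->
  exists l m', m = (U_(l) + m')%MM.
Proof.
move=> m0; have [l ml] : exists l, (0 < m l)%N.
  case: (pickP (fun l => 0 < m l)%N) => [l ml|ml0]; first by exists l.
  by case: m0; apply/mnmP => l; rewrite mnm0E; move: (ml0 l); case: (m l).
exists l, (m - U_(l))%MM; rewrite addmC submK //; apply/mnm_lepP => j.
by rewrite mnm1E; case: eqP => [<-|].
Qed.

Lemma dhomog_powX (k : fieldType) r (l : 'I_r) j :
  ('X_l ^+ j : {mpoly k[r]}) \is j.-homog.
Proof.
rewrite -{2}[j]mul1n; apply: dhomogMn; by rewrite dhomogX /= mdeg1.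
Qed.

Local Open Scope quotient_scope.
Variables (k : fieldType) (r : nat) (I : idealr {mpoly k[r]}).
Local Notation A := {ideal_quot I}.

Lemma piI (p : {mpoly k[r]}) : (\pi_A p = 0) <-> p \in I.
Proof.
by rewrite -{2}[p]subr0 Quotient.idealrBE -(rmorph0 \pi_A); split=> [->|/eqP].
Qed.

Lemma component_subspace i : subspace (@component k r I i).
Proof.
split; first by exists 0; rewrite ?rmorph0 // rpred0.
move=> a _ _ [p hp ->] [q hq ->]; exists (a *: p + q).
  by rewrite rpredD ?rpredZ.
by rewrite rmorphD /= pi_scale.
Qed.

Lemma componentM i j (a b : A) :
  component i a -> component j b -> component (i + j) (a * b).
Proof.
move=> [p hp ->] [q hq ->]; exists (p * q); first exact: dhomogM.
by rewrite rmorphM.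
Qed.

Lemma component0 i : component i (0 : A).
Proof. by case: (component_subspace i). Qed.

Lemma componentD i (a b : A) :
  component i a -> component i b -> component i (a + b).
Proof. by move=> ha hb; rewrite -[a]scale1r; apply: (component_subspace i).2. Qed.

Lemma componentZ i c (a : A) : component i a -> component i (c *: a).
Proof.
move=> ha; rewrite -[_ *: _]addr0; apply: (component_subspace i).2 => //.
exact: component0.
Qed.

Lemma componentX l : component 1 (\pi_A 'X_l : A).
Proof. by exists (mpolyX k U_(l)) => //; rewrite dhomogX /= mdeg1. Qed.

Lemma dhomog_ind (P : {mpoly k[r]} -> Prop) d :
  P 0 -> (forall a p q, P p -> P q -> P (a *: p + q)) ->
  (forall m, mdeg m = d -> P 'X_[m]) -> forall p, p \is d.-homog -> P p.
Proof.
move=> P0 PD PX p /dhomogP hp; rewrite [p]mpolyE.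
rewrite big_seq; apply: (big_rec P) => // m q /hp mP Pq.
by apply: PD => //; apply: PX.
Qed.

(** The standard grading enters here: every monomial of positive degree is divisible by a
    variable. *)
Lemma component_gen i (a : A) : component i.+1 a ->
  exists2 v : 'I_r -> A, forall l, component i (v l) &
    a = \sum_l \pi_A 'X_l * v l.
Proof.
move=> [p hp ->]; move: p hp; apply: dhomog_ind => [|c p q [v hv pE] [w hw qE]|m mi].
- exists (fun=> 0) => [l|]; first exact: component0.
  by rewrite rmorph0 big1 // => l _; rewrite mulr0.
- exists (fun l => c *: v l + w l) => [l|].
    by apply: (component_subspace i).2.
  rewrite rmorphD /= pi_scale pE qE scaler_sumr -big_split; apply: eq_bigr => l _.
  by rewrite mulrDr scalerAr.
- have [|l [m' mE]] := @mnm_split _ m.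
    by move=> m0; rewrite m0 mdeg0 in mi.
  exists (fun j => if j == l then \pi_A 'X_[m'] else 0) => [j|].
    case: eqP => _; last exact: component0.
    exists 'X_[m'] => //; rewrite dhomogX.
    by move: mi; rewrite mE mdegD mdeg1 add1n => - [mi]; apply/eqP.
  rewrite (bigD1 l) //= eqxx big1 => [|j /negPf->]; last by rewrite mulr0.
  by rewrite addr0 -rmorphM -mpolyXD -mE.
Qed.

Hypothesis homI : homogeneous_ideal I.

(** If [p] and [q] represent [a] in degrees [i] and [j], then [p - q] lies in [I] and its part of
    degree [i] is [p]. *)
Lemma component_disjoint i j (a : A) :
  component i a -> component j a -> i <> j -> a = 0.
Proof.
move=> [p hp ->] [q hq pq] /eqP ij; apply/piI.
have /homI/(_ i) : p - q \in I by apply/piI; rewrite rmorphB /= pq subrr.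
by rewrite pihomogB pihomog_dE // (pihomog_ne0 _ hq) ?subr0 // eq_sym.
Qed.

End Components.

(** * Multiplication by linear forms as matrices *)

Section Multiplication.
Local Open Scope ring_scope.
Local Open Scope quotient_scope.
Variables (k : fieldType) (r : nat) (I : idealr {mpoly k[r]}).
Local Notation A := {ideal_quot I}.
Variables (h : nat -> nat) (H : hilbert_function I h).

Local Notation subA := (@component_subspace k r I).

Definition vec i (c : 'rV_(h i)) : A :=
  combination (chosen_basis (subA i) (H i)) c.

Definition crd i (v : A) : 'rV_(h i) := chosen_coord (subA i) (H i) v.

Lemma vec_component i c : component i (@vec i c).
Proof. exact: chosen_basisS. Qed.

Lemma crdK i v : component i v -> vec (crd i v) = v.
Proof. exact: chosen_coordK. Qed.

Lemma vecK i c : crd i (vec c) = c.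
Proof. exact: chosen_basisK. Qed.

Lemma vecP i a c d : @vec i (a *: c + d) = a *: vec c + vec d.
Proof. exact: combinationP. Qed.

Lemma vecD i c d : @vec i (c + d) = vec c + vec d.
Proof. by rewrite -[c]scale1r vecP !scale1r. Qed.

Lemma vec0 i : @vec i 0 = 0.
Proof. exact: combination0. Qed.

Lemma crdP i a u v : component i u -> component i v ->
  crd i (a *: u + v) = a *: crd i u + crd i v.
Proof. by move=> hu hv; rewrite -{1}(crdK hu) -{1}(crdK hv) -vecP vecK. Qed.

Lemma vec_inj i : injective (@vec i).
Proof. exact: can_inj (@vecK i). Qed.

(** Matrices act on row vectors from the right. As [crd i.+1] is controlled only on A_(i+1), the
    matrix is used for [a] of degree 1. *)
Definition mulmat (a : A) i : 'M_(h i, h i.+1) :=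
  \matrix_j crd i.+1 (a * vec (delta_mx 0 j)).

Lemma vec_sum i (c : 'rV_(h i)) : vec c = \sum_p c 0 p *: vec (delta_mx 0 p).
Proof. exact: combination_sum. Qed.

Lemma vec_mulmat a i c : component 1 a -> vec (c *m mulmat a i) = a * vec c.
Proof.
move=> ha; rewrite /vec combination_mul -/(vec c) vec_sum mulr_sumr.
apply: eq_bigr => j _; rewrite rowK -scalerAr; congr (_ *: _); apply: crdK.
by apply: (@componentM _ _ _ 1) => //; apply: vec_component.
Qed.

Lemma mulmatC a b i : component 1 a -> component 1 b ->
  mulmat a i *m mulmat b i.+1 = mulmat b i *m mulmat a i.+1.
Proof.
move=> ha hb; apply: row_mul_inj => c; apply: vec_inj.
by rewrite !mulmxA !vec_mulmat // mulrCA.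
Qed.

(** In coordinates, the row space of the stacked matrix is aA_i + bA_i. *)
Lemma mulmat_full2 a b i : component 1 a -> component 1 b ->
  (forall v : A, component i.+1 v ->
    exists u w, [/\ component i u, component i w & v = a * u + b * w]) ->
  row_full (col_mx (mulmat a i) (mulmat b i)).
Proof.
move=> ha hb gen; rewrite -sub1mx; apply/row_subP=> j.
have [u [w [hu hw E]]] := gen _ (vec_component (row j 1%:M)).
apply/submxP; exists (row_mx (crd i u) (crd i w)); apply: vec_inj.
by rewrite mul_row_col vecD !vec_mulmat // !crdK.
Qed.

End Multiplication.

(** * Level algebras of codimension at most two *)

(** By the inequality of arithmetic and geometric means, 4ac <= (a + c)^2 <= 4b^2. *)
Lemma concave_log_concave a b c : a + c <= 2 * b -> a * c <= b ^ 2.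
Proof.
rewrite -(leq_exp2r _ _ (ltn0Sn 1)) expnMn => acb.
by rewrite -(leq_pmul2l (m := 4)) // (leq_trans _ acb) // nat_AGM2.
Qed.

Section LevelPositive.
Local Open Scope ring_scope.
Local Open Scope quotient_scope.
Variables (k : fieldType) (r : nat) (I : idealr {mpoly k[r]}).
Local Notation A := {ideal_quot I}.
Variables (h : nat -> nat) (e : nat).
Hypotheses (homI : homogeneous_ideal I) (H : hilbert_function I h).
Hypotheses (he : forall i, (e < i)%N -> h i = 0%N) (lev : level I e).

Local Notation M := (mulmat H).
Local Notation x l := (\pi_A 'X_l).

(** Such an [a] lies in the socle, hence in A_e by levelness, and A_i meets A_e only in 0. *)
Lemma level_faithful i (a : A) : (i < e)%N -> component i a ->
  (forall l, x l * a = 0) -> a = 0.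
Proof.
move=> ie ha xa; apply: (component_disjoint (j := e) homI ha); last first.
  by move=> E; rewrite E ltnn in ie.
apply: lev => m [c ->]; rewrite mulr_suml big1 // => l _.
by rewrite -mulrA xa mulr0.
Qed.

Lemma component_zero i (a : A) : (e < i)%N -> component i a -> a = 0.
Proof.
move=> /he hi ha; rewrite -(crdK H ha).
have -> : crd H i a = 0 by apply/rowP=> -[j ltj]; exfalso; rewrite hi in ltj.
exact: vec0.
Qed.

Lemma component00 (a : A) : component 0 a -> exists c : k, a = c *: 1.
Proof.
move=> [p hp ->]; exists p@_0; rewrite -(rmorph1 \pi_A) -pi_scale; congr (\pi_A _).
apply/mpolyP=> m; rewrite mcoeffZ mcoeff1.
have [->|mn0] := eqVneq m 0%MM; first by rewrite mulr1.
by rewrite (dhomog_nemf_coeff hp) ?mulr0 ?mdeg_eq0.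
Qed.

Lemma hilbert0 : (h 0 <= 1)%N.
Proof.
have h1 : component 0 (1 : A) by exists 1; [exact: dhomog1 | rewrite rmorph1].
apply: leq_trans (rank_leq_row (crd H 0 1)); rewrite -{1}(mxrank1 k (h 0%N)).
apply: mxrankS; apply/row_subP=> j; apply/submxP.
have [c cE] := component00 (vec_component H (row j 1%:M)).
exists c%:M; apply: (@vec_inj _ _ _ _ H); rewrite cE mul_scalar_mx.
by rewrite -[_ *: crd _ _ _]addr0 vecP vec0 addr0 crdK.
Qed.

(* Rank count in the Koszul complex A_i -> A_(i+1)^2 -> A_(i+2) of a and b. *)
Lemma mulmat_Koszul (a b : A) i : component 1 a -> component 1 b ->
  (forall v : A, component i.+2 v ->
    exists u w, [/\ component i.+1 u, component i.+1 w & v = a * u + b * w]) ->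
  (forall v : A, component i v -> a * v = 0 -> b * v = 0 -> v = 0) ->
  (h i + h i.+2 <= 2 * h i.+1)%N.
Proof.
move=> ha hb gen inj.
(* On elements, [P] is u -> (bu, -au) and [Q] is (u, w) -> au + bw. Injectivity of [P] and
   surjectivity of [Q] determine both ranks. *)
pose P := row_mx (M b i) (- M a i); pose Q := col_mx (M a i.+1) (M b i.+1).
have PQ : P *m Q = 0 by rewrite mul_row_col mulNmx (mulmatC H _ ha hb) subrr.
have := mulmx0_rank_max PQ; rewrite (eqP (mulmat_full2 H ha hb gen)).
suff /eqP -> : row_free P by rewrite mul2n addnn.
rewrite -kermx_eq0; apply/eqP/row_matrixP=> j; rewrite row0.
set c := row j _; have : c *m P = 0 by rewrite /c -row_mul mulmx_ker row0.
rewrite mul_mx_row mulmxN => /eqP; rewrite -row_mx0 => /eqP/eq_row_mx [cb /eqP].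
rewrite oppr_eq0 => /eqP ca; apply: (@vec_inj _ _ _ _ H); rewrite vec0.
apply: inj; first exact: vec_component.
- by rewrite -vec_mulmat // ca vec0.
- by rewrite -vec_mulmat // cb vec0.
Qed.

End LevelPositive.

Theorem log_concave_codim_le2 (k : fieldType) (r t : nat) :
  0 < r -> r <= 2 -> all_level_log_concave k r t.
Proof.
move=> r0 r2 h [I [[homI _ _] H [e [[_ he] lev _]]]] [//|i] _ /=.
case: (ltnP e i.+2) => [/he->|ie]; first by rewrite muln0.
have ie' : i < e by lia.
case: r r0 r2 I homI H lev => [|[|[|]]] // _ _ I homI H lev.
(* In one variable A_(j+1) = xA_j, so [h] is nonincreasing with values at most 1. *)
- have lt1 j : h j.+1 <= h j.
    have h1 := componentX I ord0.
    pose M := mulmat H (\pi_{ideal_quot I} 'X_ord0)%qT j.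
    (* The criterion for two linear forms is used with both equal to the single variable. *)
    have : row_full (col_mx M M).
      apply: mulmat_full2 => // v hv.
      have [w hw ->] := component_gen hv.
      exists (w ord0), 0%R; rewrite big_ord1 mulr0 addr0; split=> //.
      exact: component0.
    by move/eqP; rewrite -addsmxE (addsmx_idPl _) // => {1}<-; exact: rank_leq_row.
  have {}h0 := hilbert0 H.
  have hle j : h j <= 1 by elim: j => // j; apply: leq_trans.
  move: (lt1 i) (lt1 i.+1) (hle i) (hle i.+1); nia.
- apply: concave_log_concave.
  have h0 := componentX I ord0; have h1 := componentX I ord_max.
  apply: (mulmat_Koszul H h0 h1) => // [v hv|v hv xv yv].
    have [w hw ->] := component_gen hv.
    exists (w ord0), (w ord_max); split=> //.
    rewrite big_ord_recl big_ord1.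
    by have -> : lift ord0 ord0 = ord_max :> 'I_2 by apply: val_inj.
  apply: (level_faithful homI lev ie') => // l.
  by have [->|->] : l = ord0 \/ l = ord_max by
    case: l => [[|[|]]] // ?; [left|right]; apply: val_inj.
Qed.

(** * Evaluation at a point *)

Section PointEvaluation.
Local Open Scope ring_scope.
Local Open Scope quotient_scope.
Variables (k : fieldType).

Lemma widen_lift n (i : 'I_n) : widen_ord (leqnSn n) i = lift ord_max i.
Proof. by apply: val_inj; rewrite /= /bump leqNgt ltn_ord. Qed.

Lemma meval_muni n (p : {mpoly k[n.+1]}) (v : 'I_n -> k) (x : k) :
  (map_poly (meval v) (muni p)).[x] =
  p.@[fun i => if unlift ord_max i is Some j then v j else x].
Proof.
rewrite muniE mevalE rmorph_sum horner_sum; apply: eq_bigr => m _ /=.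
rewrite -mul_polyC rmorphM /= map_polyC map_polyXn hornerM hornerC hornerXn.
rewrite /= mevalZ mevalX big_ord_recr /= unlift_none mulrA; congr (_ * _ * _).
by apply: eq_bigr => i _; rewrite mnmE widen_lift liftK.
Qed.

(** The coefficient of [p] at [m] is read off [muni p]: first at the exponent of the last variable,
    then at the remaining exponents [m']. *)
Lemma muni_inj n : injective (@muni n k).
Proof.
apply: raddf_inj => p p0; apply/mpolyP => m.
transitivity (0 : k); last exact/esym/mcoeff0.
pose m' := [multinom m (widen_ord (leqnSn n) i) | i < n].
have : ((muni p)`_(m ord_max))@_m' = 0 by rewrite p0 coef0; exact: mcoeff0.
rewrite muniE coef_sum raddf_sum /= => <-.
rewrite {1}[p]mpolyE raddf_sum /=; apply: eq_bigr => m2 _.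
rewrite coefZ coefXn mcoeffZ mcoeffX.
case: eqP => [->|ne].
  by rewrite eqxx mulr1 mulr1 mcoeffZ mcoeffX eqxx mulr1.
rewrite mulr0; case: eqP => [em|_]; last by rewrite mulr0 mcoeff0.
rewrite mulr1 mcoeffZ mcoeffX; case: eqP => [em'|_]; last by rewrite mulr0.
case: ne.
apply/mnmP => i; case: (unliftP ord_max i) => [j ->|->] //.
by move/mnmP/(_ j): em'; rewrite !mnmE widen_lift.
Qed.

(** Starting from 0, an element outside the list [pre n] of the terms so far is adjoined at each
    step. The sequence later supplies the coordinates of the grids; its value 0 at index 0 provides
    their origins. *)
Lemma infinite_field_inj : infinite_field k ->
  exists2 c : nat -> k, injective c & c 0%N = 0.
Proof.
move=> kinf; pose pre n := iter n (fun s => rcons s (xchoose (kinf s))) [:: 0].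
have cpre m n : (m <= n)%N -> last 0 (pre m) \in pre n.
  elim: n => [|n IH]; first by rewrite leqn0 => /eqP ->; rewrite /= inE.
  rewrite leq_eqVlt => /predU1P[->|/IH pmn]; rewrite /= mem_rcons inE.
    by rewrite last_rcons eqxx.
  by rewrite pmn orbT.
have c_lt m n : (m < n)%N -> last 0 (pre m) != last 0 (pre n).
  case: n => // n; rewrite ltnS => /cpre pmn; rewrite /= last_rcons.
  have nx : xchoose (kinf (pre n)) \notin pre n by have := xchooseP (kinf (pre n)).
  by apply: contraNneq nx => <-.
exists (fun n => last 0 (pre n)) => // m n E; apply/eqP; rewrite eqn_leq.
by apply/andP; split; rewrite leqNgt; apply/negP => /c_lt; rewrite E eqxx.
Qed.

(** Induction on the number of variables: a point where the leading coefficient in the last variable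
    is nonzero leaves a nonzero polynomial [q] in one variable. *)
Lemma mpoly_nonroot n (p : {mpoly k[n]}) :
  infinite_field k -> p != 0 -> exists v : 'I_n -> k, p.@[v] != 0.
Proof.
move=> kinf; elim: n p => [|n IH] p p0.
  exists (fun=> 0); move: p0; have [c ->] : exists c, p = c%:MP.
    exists p@_0; apply/mpolyP=> m; rewrite mcoeffC.
    have -> : m = 0%MM by apply/mnmP => -[].
    by rewrite eqxx mulr1.
  by rewrite mevalC mpolyC_eq0.
have up0 : lead_coef (muni p) != 0.
  by rewrite lead_coef_eq0 -(inj_eq (@muni_inj n)) raddf0 in p0 *.
have [v vP] := IH _ up0; pose q := map_poly (meval v) (muni p).
have q0 : q != 0.
  apply: contra_neq vP => qE.
  by rewrite lead_coefE -(coef_map (meval v)) -/q qE coef0.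
have [x qx] : exists x, ~~ root q x.
  apply: NNPP => nex; have [c c_inj _] := infinite_field_inj kinf.
  (* A nonzero [q] has fewer than [size q] roots, so the first [size q] terms of an injective
     sequence cannot all be roots. *)
  have := max_poly_roots (rs := mkseq c (size q)) q0.
  rewrite size_mkseq ltnn mkseq_uniq // => /(_ _ isT).
  suff -> : all (root q) (mkseq c (size q)) by move/(_ isT).
  by apply/allP => x _; apply: contra_notT nex => ?; exists x.
exists (fun i => if unlift ord_max i is Some j then v j else x).
by rewrite -meval_muni.
Qed.

Variable r : nat.
Local Notation R := {mpoly k[r.+1]}.

(* Modulo the linear forms vanishing at v, every X_j is a multiple of X_0. *)
Lemma meval_dhomog_at (v : 'I_r.+1 -> k) d (p : R) : p \is d.+1.-homog ->
  exists2 u : 'I_r.+1 -> R, forall j, u j \is d.-homog &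
    v ord0 ^+ d.+1 *: p - p.@[v] *: 'X_ord0 ^+ d.+1 =
    \sum_j (v ord0 *: 'X_j - v j *: 'X_ord0) * u j.
Proof.
pose P d (p : R) := exists2 u : 'I_r.+1 -> R, forall j, u j \is d.-homog &
    v ord0 ^+ d.+1 *: p - p.@[v] *: 'X_ord0 ^+ d.+1 =
    \sum_j (v ord0 *: 'X_j - v j *: 'X_ord0) * u j.
have PD d' a q q' : P d' q -> P d' q' -> P d' (a *: q + q').
  move=> [u hu uE] [w hw wE]; exists (fun j => a *: u j + w j) => [j|].
    by rewrite rpredD ?rpredZ.
  under eq_bigr do rewrite mulrDr -scalerAr.
  rewrite big_split /= -scaler_sumr -uE -wE mevalD mevalZ scalerDr scalerBr.
  rewrite !scalerA !scalerDl [v ord0 ^+ _ * a]mulrC opprD addrACA.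
  by rewrite -!addrA; congr (_ + _); rewrite !addrA; congr (_ + _); rewrite addrC.
have P0 d' : P d' 0.
  exists (fun=> 0) => [j|]; first exact: rpred0.
  by rewrite scaler0 meval0 scale0r subr0 big1 // => j _; rewrite mulr0.
move: p; apply: dhomog_ind => [|a p q|]; [exact: P0 | exact: PD |].
elim: d => [|d IH] m.
  move/eqP/mdeg1P => [j /eqP ->]; exists (fun i => (i == j)%:R) => [i|].
    by case: eqP => _; rewrite ?rpred0 ?dhomog1.
  rewrite (bigD1 j) //= eqxx mulr1 big1 => [|i /negPf->]; last by rewrite mulr0.
  by rewrite addr0 !expr1 mevalXU.
move=> mE; have [|j [m' Em]] := @mnm_split _ m.
  by move=> m0; rewrite m0 mdeg0 in mE.
have m'E : mdeg m' = d.+1 by move: mE; rewrite Em mdegD mdeg1 add1n => -[].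
have [u hu uE] := IH m' m'E.
(* In the product of [X_j] and [m'], the factor [X_j] is first traded for a multiple of [X_0]; the
   induction hypothesis then treats [m'], multiplied by [X_0]. *)
exists (fun i => (i == j)%:R * (v ord0 ^+ d.+1 *: 'X_[m']) +
  v j *: ('X_ord0 * u i)) => [i|].
  apply: rpredD; last first.
    apply: rpredZ; rewrite -[d.+1]/(1 + d)%N; apply: dhomogM => //.
    by rewrite dhomogX /= mdeg1.
  case: eqP => _; first by rewrite mul1r rpredZ // dhomogX; exact/eqP.
  by rewrite mul0r rpred0.
transitivity (\sum_i (i == j)%:R * ((v ord0 *: 'X_i - v i *: 'X_ord0) *
    (v ord0 ^+ d.+1 *: 'X_[m'])) + v j *: ('X_ord0 *
    \sum_i (v ord0 *: 'X_i - v i *: 'X_ord0) * u i)); last first.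
  rewrite mulr_sumr scaler_sumr -big_split; apply: eq_bigr => i _ /=.
  by rewrite -!mul_mpolyC; ring.
rewrite -uE (bigD1 j) //= eqxx mul1r big1 => [|i /negPf->]; last by rewrite mul0r.
rewrite addr0 Em mpolyXD mevalM mevalXU.
rewrite -!mul_mpolyC !mpolyCM !rmorphXn /=.
rewrite !exprS; ring.
Qed.

End PointEvaluation.

(** * Gorenstein algebras of codimension three *)

Section Gorenstein.
Local Open Scope ring_scope.
Local Open Scope quotient_scope.
Variables (k : fieldType) (r : nat) (I : idealr {mpoly k[r]}).
Local Notation A := {ideal_quot I}.
Variables (h : nat -> nat) (e : nat).
Hypotheses (homI : homogeneous_ideal I) (H : hilbert_function I h).

Local Notation M := (mulmat H).

(** With g_n = dim (A/aA)_n this is g_(i+2) <= g_(i+1), written without subtraction: multiplication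
    by [b] maps (A/aA)_(i+1) onto (A/aA)_(i+2). *)
Lemma mulmat_rank_mono (a b : A) i : component 1 a -> component 1 b ->
  (forall v : A, component i.+2 v ->
    exists u w, [/\ component i.+1 u, component i.+1 w & v = a * u + b * w]) ->
  (h i.+2 + \rank (M a i) <= h i.+1 + \rank (M a i.+1))%N.
Proof.
move=> ha hb gen; have full := mulmat_full2 H ha hb gen.
set U := M a i; set Ma := M a i.+1; set Mb := M b i.+1.
have UMb : (U *m Mb <= Ma)%MS by rewrite /U (mulmatC H i ha hb) submxMl.
(* Since b(aA_i) lies in aA_(i+1), only a complement of aA_i in A_(i+1) contributes new elements
   under [b]. *)
have MbS : (Mb <= Ma + U^C *m Mb)%MS.
  rewrite -{1}[Mb]mul1mx; apply: submx_trans (submxMr Mb (_ : _ <= U + U^C)%MS) _.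
    by rewrite submx_full // addsmx_compl_full.
  by rewrite addsmxMr addsmxS.
have : (\rank (col_mx Ma Mb) <= \rank (Ma + U^C *m Mb)%MS)%N.
  by rewrite -addsmxE mxrankS // addsmx_sub addsmxSl.
rewrite (eqP full) => /leq_trans/(_ (mxrank_adds_leqif _ _)) le2.
have := mxrankM_maxl (U^C)%MS Mb; rewrite mxrank_compl.
have := rank_leq_col U; lia.
Qed.

Hypotheses (lev : level I e) (he1 : h e = 1%N).

(* The isomorphism of the one-dimensional A_e with k, as a sum over one index. *)
Definition top_form (a : A) : k := \sum_j crd H e a 0 j.

Lemma top_formP c (a b : A) : component e a -> component e b ->
  top_form (c *: a + b) = c * top_form a + top_form b.
Proof.
move=> ha hb; rewrite /top_form crdP // mulr_sumr -big_split /=.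
by apply: eq_bigr => j _; rewrite !mxE.
Qed.

Lemma top_form_eq0 (a : A) : component e a -> top_form a = 0 -> a = 0.
Proof.
move=> ha; rewrite /top_form => a0; rewrite -(crdK H ha).
suff -> : crd H e a = 0 by apply: vec0.
apply/rowP=> j; rewrite mxE -[RHS]a0 (big_pred1 j) // => i; symmetry.
by apply/eqP/val_inj; case: i j => i + [j] /=; rewrite he1; case: i j => [|?] [|?].
Qed.

(** Induction on [j]: a variable moves from the test element onto [a], so each product of [a] with a
    variable vanishes by the case [j - 1], and levelness gives a = 0. *)
Lemma top_form_faithful i j (a : A) : (i + j)%N = e -> component i a ->
  (forall b, component j b -> top_form (a * b) = 0) -> a = 0.
Proof.
elim: j i a => [|j IH] i a ij ha orth.
  rewrite addn0 in ij; subst i; apply: top_form_eq0 => //.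
  rewrite -[a]mulr1; apply: orth; exists 1; [exact: dhomog1 | by rewrite rmorph1].
apply: (level_faithful homI lev _ ha) => [|l].
  by rewrite -ij addnS ltnS leq_addr.
have hx := componentX I l.
apply: (IH i.+1) => [||b hb]; first by rewrite -ij addSnnS.
  exact: (componentM hx ha).
by rewrite [_ * a]mulrC -mulrA; apply/orth/(componentM hx hb).
Qed.

Definition pairing i j : 'M_(h i, h j) := \matrix_(p, q)
  top_form (vec H (delta_mx 0 p : 'rV_(h i)) * vec H (delta_mx 0 q : 'rV_(h j))).

Lemma top_form_sum (T : finType) (c : T -> k) (F : T -> A) :
  (forall p, component e (F p)) ->
  top_form (\sum_p c p *: F p) = \sum_p c p * top_form (F p).
Proof.
(* Linearity of [top_form] is available on A_e only, so membership in A_e is carried through the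
   induction. *)
move=> hF; suff [] : component e (\sum_p c p *: F p) /\
  top_form (\sum_p c p *: F p) = \sum_p c p * top_form (F p) by [].
apply: (big_ind2 (fun x y => component e x /\ top_form x = y)).
- split; first exact: component0.
  have := @top_formP (-1) 0 0 (component0 _ _) (component0 _ _).
  by rewrite scaler0 addr0 mulN1r addNr.
- move=> x _ y _ [hx <-] [hy <-]; split; first exact: componentD.
  by rewrite -{1}[x]scale1r top_formP // mul1r.
- move=> p _; split; first exact: componentZ.
  have := @top_formP (-1) 0 0 (component0 _ _) (component0 _ _).
  rewrite scaler0 addr0 mulN1r addNr => t0.
  by rewrite -[_ *: _]addr0 top_formP ?t0 ?addr0 //; apply: component0.
Qed.

Lemma pairingE i j (c : 'rV_(h i)) (d : 'rV_(h j)) : (i + j)%N = e ->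
  (c *m pairing i j *m d^T) 0 0 = top_form (vec H c * vec H d).
Proof.
move=> ij; have hv p q : component e (vec H (p : 'rV_(h i)) * vec H (q : 'rV_(h j))).
  by rewrite -ij; apply: componentM; apply: vec_component.
rewrite (vec_sum H c) mulr_suml; under eq_bigr do rewrite -scalerAl.
rewrite top_form_sum // -mulmxA mxE; apply: eq_bigr => p _; congr (_ * _).
rewrite (vec_sum H d) mulr_sumr; under eq_bigr do rewrite -scalerAr.
rewrite top_form_sum // mxE; apply: eq_bigr => q _.
by rewrite !mxE mulrC.
Qed.

Lemma pairing_tr i j : (pairing i j)^T = pairing j i.
Proof. by apply/matrixP=> p q; rewrite !mxE mulrC. Qed.

Lemma pairing_free i j : (i + j)%N = e -> row_free (pairing i j).
Proof.
move=> ij; rewrite -kermx_eq0; apply/eqP/row_matrixP=> l; rewrite row0.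
set c := row l _; have cP : c *m pairing i j = 0.
  by rewrite /c -row_mul mulmx_ker row0.
apply: (@vec_inj _ _ _ _ H); rewrite vec0.
apply: (top_form_faithful ij (vec_component H c)) => b hb.
by rewrite -(crdK H hb) -pairingE // cP mul0mx mxE.
Qed.

(** The pairing matrix and its transpose are both row free. *)
Lemma hilbert_sym i j : (i + j)%N = e -> h i = h j.
Proof.
move=> ij; rewrite -(eqP (pairing_free ij)) -mxrank_tr pairing_tr.
by apply/eqP/pairing_free; rewrite addnC.
Qed.

(** By the identity (au)w = u(aw), the two multiplication maps are adjoint with respect to the
    perfect pairings. *)
Lemma mulmat_rank_sym (a : A) i j : component 1 a -> (i + j).+1 = e ->
  \rank (M a i) = \rank (M a j).
Proof.
move=> ha ij.
have eij : (i.+1 + j)%N = e by rewrite addSn.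
have eij' : (i + j.+1)%N = e by rewrite addnS.
have adj : M a i *m pairing i.+1 j = pairing i j.+1 *m (M a j)^T.
  apply: row_mul_inj => c; apply: (can_inj trmxK); apply: row_mul_inj => d.
  apply: (can_inj trmxK); rewrite !trmx_mul !trmxK.
  apply/rowP=> l; rewrite ord1 !mulmxA (pairingE _ _ eij).
  rewrite -[_ *m _ *m _^T]mulmxA -trmx_mul (pairingE _ _ eij').
  by rewrite !vec_mulmat // mulrCA mulrA.
rewrite -(mxrankMfree (M a i) (pairing_free eij)) adj.
rewrite -mxrank_tr trmx_mul trmxK pairing_tr mxrankMfree //.
by apply: pairing_free; rewrite addnC.
Qed.

End Gorenstein.

Section CodimensionThree.
Local Open Scope ring_scope.
Local Open Scope quotient_scope.

(** A basis of the forms of degree [i] stays a basis modulo [I]. *)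
Lemma component_full_dim (k : fieldType) (n : nat) (I : idealr {mpoly k[n.+1]})
    (h : nat -> nat) i :
  hilbert_function I h ->
  (forall p : {mpoly k[n.+1]}, p \is i.-homog -> p \in I -> p = 0) ->
  h i = 'C(i + n, i).
Proof.
move=> H I0; pose W := dhomog n.+1 k i.
have -> : 'C(i + n, i) = \dim {:W} by rewrite dimvf.
apply: has_dim_uniq (component_subspace I i) (H i) _.
pose b j : {mpoly k[n.+1]} := val ((vbasis {:W})`_j).
exists (fun j => \pi_{ideal_quot I} (b j)); split=> [j|_ [p hp ->]].
  by exists (b j) => //; apply: dhomog_is_dhomog.
have E (c : 'I_(\dim {:W}) -> k) : \sum_j c j *: \pi_{ideal_quot I} (b j) =
    \pi_{ideal_quot I} (val (\sum_j c j *: (vbasis {:W})`_j)).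
  by rewrite !raddf_sum; apply: eq_bigr => j _; rewrite -pi_scale.
pose w : W := DHomog hp; pose c := [ffun j => coord (vbasis {:W}) j w].
have wE : w = \sum_j c j *: (vbasis {:W})`_j.
  by rewrite {1}(coord_vbasis (memvf w)); apply: eq_bigr => j _; rewrite ffunE.
exists c; split=> [|c']; first by rewrite E -wE.
rewrite E => /eqP; rewrite -subr_eq0 -raddfB /= => /eqP/piI.
rewrite -[p]/(val w) -raddfB => /(I0 _ (dhomog_is_dhomog _)) q0.
have /(canRL (subrK _)) : w - \sum_j c' j *: (vbasis {:W})`_j = 0 by apply: val_inj.
rewrite add0r => wc'.
apply/ffunP=> j; rewrite ffunE wc' coord_sum_free //.
exact: basis_free (vbasisP _).
Qed.

(** Subtracting a multiple of [f * 'X_ord0 ^+ (i.+1 - d)], which lies in [I], makes the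
    representative vanish at [v]. By [meval_dhomog_at] it is then a combination of the linear forms
    vanishing at [v]. *)
Lemma component_gen_at (k : fieldType) (n : nat) (I : idealr {mpoly k[n.+1]})
    (f : {mpoly k[n.+1]}) (v : 'I_n.+1 -> k) d i :
  f \in I -> f \is d.-homog -> f.@[v] != 0 -> v ord0 != 0 -> (d <= i.+1)%N ->
  forall a : {ideal_quot I}, component i.+1 a ->
  exists2 u : 'I_n.+1 -> {ideal_quot I}, forall j, component i (u j) &
    a = \sum_j \pi_{ideal_quot I} (v ord0 *: 'X_j - v j *: 'X_ord0) * u j.
Proof.
move=> fI fd fv v0 di _ [p hp ->]; pose g := f * 'X_ord0 ^+ (i.+1 - d).
have gI : g \in I by rewrite /g mulrC idealMr.
have gd : g \is i.+1.-homog.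
  rewrite -(subnKC di); apply: dhomogM => //.
  exact: dhomog_powX.
have gv : g.@[v] != 0.
  by rewrite mevalM mulf_neq0 // rmorphXn /= mevalXU expf_neq0.
pose q := p - (p.@[v] / g.@[v]) *: g.
have qd : q \is i.+1.-homog by rewrite rpredB ?rpredZ.
have qv : q.@[v] = 0 by rewrite mevalB mevalZ divfK ?subrr.
have -> : \pi_{ideal_quot I} p = \pi_{ideal_quot I} q.
  by rewrite rmorphB /= pi_scale ((piI I g).2 gI) scaler0 subr0.
have [u hu] := meval_dhomog_at v qd; rewrite qv scale0r subr0 => uE.
pose c := (v ord0 ^+ i.+1)^-1.
exists (fun j => \pi_{ideal_quot I} (c *: u j)) => [j|].
  exists (c *: u j) => //; apply: rpredZ; exact: hu.
have -> : q = c *: (v ord0 ^+ i.+1 *: q).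
  by rewrite scalerA mulVf ?scale1r ?expf_neq0.
rewrite uE scaler_sumr rmorph_sum; apply: eq_bigr => j _.
by rewrite scalerAr rmorphM.
Qed.

End CodimensionThree.

Lemma symmetric_log_concave (h : nat -> nat) e i : 0 < i < e ->
  (forall j, j <= e -> h j = h (e - j)) ->
  (forall j, 0 < j -> 2 * j <= e -> h j.-1 * h j.+1 <= h j ^ 2) ->
  h i.-1 * h i.+1 <= h i ^ 2.
Proof.
move=> ie sym lc; case: (leqP (2 * i) e) => [|lt]; first by apply: lc; lia.
rewrite (sym i.-1) ?(sym i.+1) ?(sym i); try lia.
have -> : e - i.-1 = (e - i).+1 by lia.
have -> : e - i.+1 = (e - i).-1 by lia.
by rewrite mulnC; apply: lc; lia.
Qed.

Lemma binomial2_log_concave j :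
  'C(j.+2, 2) * 'C(j.+4, 2) <= 'C(j.+3, 2) ^ 2.
Proof.
have b2 m : 2 * 'C(m.+2, 2) = m.+2 * m.+1 by rewrite -mul_bin_diag bin1.
rewrite -(leq_pmul2l (m := 4)) // -[4]/(2 * 2) mulnACA -[2 * 2]/(2 ^ 2) -expnMn !b2.
rewrite mulnACA mulnC; nia.
Qed.

Theorem log_concave_Gorenstein_codim3 (k : fieldType) :
  infinite_field k -> all_level_log_concave k 3 1.
Proof.
move=> kinf h [I [[homI _ _] H [e [[_ he] lev he1]]]] i i1.
have [le_ei|ie] := leqP e i; first by rewrite (he i.+1) ?muln0.
pose vanish d := exists2 p, p \is d.-homog & p \in I /\ p != 0%R.
have [d [dP dmin]] : exists d, vanish d /\ forall j, j < d -> ~ vanish j.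
  (* Without a least degree, [I] would contain no nonzero form at all; yet the power e + 1 of [X_0]
     lies in [I], as A vanishes above [e]. *)
  apply: NNPP => nex; suff nv d : forall j, j < d -> ~ vanish j.
    apply: (nv e.+2 e.+1) => //; exists ('X_ord0 ^+ e.+1)%R.
      exact: dhomog_powX.
    split; last by rewrite expf_neq0 // mpolyX_neq0.
    apply/piI/(component_zero H he (ltnSn e)); exists ('X_ord0 ^+ e.+1)%R => //.
    exact: dhomog_powX.
  elim: d => // d IH j; rewrite ltnS leq_eqVlt => /predU1P[->|/IH //] vd.
  by apply: nex; exists d.
have hbin j : j < d -> h j = 'C(j.+2, 2).
  move=> /dmin nv; rewrite (component_full_dim (i := j) H).
    by rewrite addn2 -(bin_sub (n := j.+2) (m := 2)) // subn2.
  by move=> p hp pI; apply/eqP; apply: contra_notT nv => p0; exists p.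
have [f fd [fI f0]] := dP.
(* The factor [X_0] ensures that [v ord0] is nonzero as well. *)
have [v] := mpoly_nonroot kinf (mulf_neq0 f0 (mpolyX_neq0 k U_(ord0)%MM)).
rewrite mevalM mevalXU mulf_eq0 negb_or => /andP [fv v0].
pose a j : {ideal_quot I} :=
  (\pi_{ideal_quot I}%qT (v ord0 *: 'X_j - v j *: 'X_ord0))%R.
have ha j : component 1 (a j).
  exists (v ord0 *: 'X_j - v j *: 'X_ord0)%R => //.
  by rewrite rpredB // rpredZ // dhomogX /= mdeg1.
pose j1 : 'I_3 := inord 1; pose j2 : 'I_3 := inord 2.
pose rho j := \rank (mulmat H (a j1) j).
have mono j : d <= j.+2 -> h j.+2 + rho j <= h j.+1 + rho j.+1.
  move=> dj; apply: (mulmat_rank_mono H (ha j1) (ha j2)) => w hw.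
  have [u hu ->] := component_gen_at fI fd fv v0 dj hw.
  (* The form of index 0 in the sum is identically 0, so two linear forms remain. *)
  exists (u j1), (u j2); split=> //; rewrite !big_ord_recl big_ord0.
  rewrite subrr rmorph0 mul0r add0r addr0.
  by have -> : lift ord0 ord0 = j1; [|have -> : lift ord0 (lift ord0 ord0) = j2];
    try (by apply: val_inj; rewrite /= inordK).
have sym j : j <= e -> h j = h (e - j).
  by move=> je; apply: (hilbert_sym homI H lev he1); rewrite subnKC.
have rsym j l : (j + l).+1 = e -> rho j = rho l.
  exact: (mulmat_rank_sym homI H lev he1 (ha j1)).
apply: (symmetric_log_concave (e := e)) => // [|j j0 je]; first by rewrite ie i1.
case: j j0 je => //= j _ je; have [lt|ge] := ltnP j.+2 d.
  have b2 m : 2 * 'C(m.+2, 2) = m.+2 * m.+1 by rewrite -mul_bin_diag bin1.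
  by rewrite !hbin; try lia; apply: binomial2_log_concave.
apply: concave_log_concave.
(* The mirror of [j] is [e - j]. Monotonicity there reads [h j + rho j.+1 <= h j.+1 + rho j] by
   duality; adding the inequality at [j] cancels the ranks. *)
have dl : d <= (e - j.+2).+2 by lia.
have hj : h (e - j.+2).+2 = h j by rewrite [RHS]sym; [congr h|]; lia.
have hj1 : h (e - j.+2).+1 = h j.+1 by rewrite [RHS]sym; [congr h|]; lia.
have rj : rho (e - j.+2) = rho j.+1 by apply: rsym; lia.
have rj1 : rho (e - j.+2).+1 = rho j by apply: rsym; lia.
move: (mono _ dl) (mono _ ge); rewrite hj hj1 rj rj1.
move: (h _) (h _) (h _) (rho _) (rho _) => *; lia.
Qed.

(** * Ideals apolar to sums of point evaluations *)

Section Dimension.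
Local Open Scope ring_scope.
Variables (k : fieldType) (V : lmodType k).

(** Both the span of [v] and the row space of [E] are the quotient of k^N by the same kernel. The
    rows of [C] lift a basis of the row space. *)
Lemma has_dim_rank (N N' : nat) (v : 'I_N -> V) (E : 'M[k]_(N, N'))
    (S : V -> Prop) :
  (forall c, combination v c = 0 <-> c *m E = 0) ->
  (forall x, S x <-> exists c, x = combination v c) ->
  has_dim S (\rank E).
Proof.
move=> vE SP; pose C := row_base E *m pinvmx E.
have CE : C *m E = row_base E by rewrite mulmxKpV // eq_row_base.
pose b j := combination v (row j C).
have bE d : combination b d = combination v (d *m C).
  by rewrite combination_mul.
exists b; split=> [j|x /SP[c ->]]; first by apply/SP; exists (row j C).
have [d dE] : exists d, c *m E = d *m row_base E.
  by apply/submxP; rewrite eq_row_base submxMl.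
exists [ffun j => d 0 j]; split=> [|d'].
  transitivity (combination b d); last by apply: eq_bigr => j _; rewrite ffunE.
  rewrite bE; apply/eqP; rewrite -subr_eq0 -scaleN1r addrC -combinationP.
  by apply/eqP/vE; rewrite mulmxDl -scalemxAl -mulmxA CE dE scaleN1r addNr.
pose d2 : 'rV_(\rank E) := \row_j d' j => E2.
have {}E2 : combination v c = combination v (d2 *m C).
  by rewrite -bE E2; apply: eq_bigr => j _; rewrite mxE.
have : combination v (-1 *: (d2 *m C) + c) = 0.
  by rewrite combinationP scaleN1r -E2 addNr.
move/vE; rewrite mulmxDl -scalemxAl -mulmxA CE dE scaleN1r addrC => /eqP.
rewrite subr_eq0 => /eqP/(row_free_inj (row_base_free E)) dd.
by apply/ffunP=> j; rewrite ffunE dd mxE.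
Qed.

Lemma combination_map (U W : lmodType k) (g : U -> W) n (p : 'I_n -> U) c :
  (forall a u v, g (a *: u + v) = a *: g u + g v) ->
  g (combination p c) = combination (g \o p) c.
Proof.
move=> gP; have g0 : g 0 = 0.
  by have := gP (-1) 0 0; rewrite scaler0 addr0 scaleN1r addNr.
by apply: (big_rec2 (fun u w => g u = w)) => // j u w _ <-; rewrite gP.
Qed.

(** A basis of [S] is lifted to [T]. A relation between the value rows of the lifts gives an element
    of [T] killed by all functionals, hence a relation in [S]. *)
Lemma has_dim_le_functionals (W : lmodType k) (f : W -> V) (S : V -> Prop) n
    (K : finType) (F : K -> W -> k) (T : W -> Prop) :
  (forall a p q, f (a *: p + q) = a *: f p + f q) ->
  (forall x a p q, F x (a *: p + q) = a * F x p + F x q) ->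
  subspace T -> (forall v, S v -> exists2 p, T p & v = f p) ->
  (forall p, T p -> (forall x, F x p = 0) -> f p = 0) ->
  subspace S -> has_dim S n -> (n <= #|K|)%N.
Proof.
move=> fL FL subT fT ker subS Sn.
have [b Sb ind] := has_dim_independent Sn subS.
have ex j : exists p, T p /\ b j = f p by have [p] := fT _ (Sb j); exists p.
pose p j := proj1_sig (constructive_indefinite_description _ (ex j)).
have pP j : T (p j) /\ b j = f (p j).
  exact: proj2_sig (constructive_indefinite_description _ (ex j)).
pose C := \matrix_(j < n, x < #|K|) F (enum_val x) (p j).
suff /eqP <- : row_free C by apply: rank_leq_col.
rewrite -kermx_eq0; apply/eqP/row_matrixP=> i; rewrite row0.
set c := row i _; have cC : c *m C = 0 by rewrite /c -row_mul mulmx_ker row0.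
have fc : f (combination p c) = \sum_j c 0 j *: b j.
  rewrite combination_map //; apply: eq_bigr => j _ /=.
  by rewrite -(pP j).2.
have {}ind := ind (c 0); apply/rowP=> j; rewrite [RHS]mxE; apply: ind.
rewrite -fc; apply: ker => [|x].
  by apply: subspace_combination => // l; apply: (pP l).1.
rewrite (@combination_map W k^o) //= /combination.
have /rowP/(_ (enum_rank x)) := cC; rewrite [RHS]mxE [LHS]mxE => c0.
transitivity (\sum_l c 0 l * C l (enum_rank x)); last exact: c0.
by apply: eq_bigr => l _; rewrite [C _ _]mxE enum_rankK.
Qed.

End Dimension.

Section PointFunctionals.
Local Open Scope ring_scope.
Local Open Scope quotient_scope.
Variables (k : fieldType) (n t e : nat) (Z : finType) (s : Z -> 'I_t).
Variables (P : Z -> 'I_n -> k).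
Local Notation R := {mpoly k[n]}.

(** The functional on forms of degree [e] is extended by 0 to all other degrees, which makes its
    apolar ideal homogeneous. *)
Definition point_form (i : 'I_t) (p : R) : k :=
  \sum_(z | s z == i) (pihomog mdeg e p).@[P z].

Lemma point_formP i a p q :
  point_form i (a *: p + q) = a * point_form i p + point_form i q.
Proof.
rewrite /point_form mulr_sumr -big_split /=; apply: eq_bigr => z _.
by rewrite linearP mevalD mevalZ.
Qed.

Lemma point_form0 i : point_form i 0 = 0.
Proof. by rewrite /point_form big1 // => z _; rewrite linear0 meval0. Qed.

Lemma pihomog_mull d j (p q : R) : p \is d.-homog ->
  pihomog mdeg (d + j) (p * q) = p * pihomog mdeg j q.
Proof.
move=> hp; elim/mpolyind: q => [|c m q _ _ IH]; first by rewrite mulr0 !linear0 mulr0.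
rewrite mulrDr -scalerAr !pihomogD !linearZ IH /= mulrDr -scalerAr; congr (_ *: _ + _).
have hm : p * 'X_[m] \is (d + mdeg m).-homog by apply: dhomogM => //; rewrite dhomogX.
rewrite pihomogX; have [mj|mj] := eqVneq (mdeg m) j.
  by rewrite pihomog_dE // -mj.
by rewrite mulr0 (pihomog_ne0 _ hm) // eqn_add2l.
Qed.

Lemma pihomog_mull_gt d (p q : R) : (e < d)%N -> p \is d.-homog ->
  pihomog mdeg e (p * q) = 0.
Proof.
move=> ed hp; elim/mpolyind: q => [|c m q _ _ IH]; first by rewrite mulr0 linear0.
rewrite mulrDr -scalerAr pihomogD linearZ IH /= addr0.
have hm : p * 'X_[m] \is (d + mdeg m).-homog by apply: dhomogM => //; rewrite dhomogX.
by rewrite (pihomog_ne0 _ hm) ?scaler0 //; apply/eqP; lia.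
Qed.

Lemma point_form_mul i d j (p q : R) : (d + j)%N = e -> p \is d.-homog ->
  point_form i (p * q) =
  \sum_(z | s z == i) p.@[P z] * (pihomog mdeg j q).@[P z].
Proof.
move=> dj hp; apply: eq_bigr => z _.
by rewrite -dj pihomog_mull // mevalM.
Qed.

Lemma point_form_gt i d (p q : R) : (e < d)%N -> p \is d.-homog ->
  point_form i (p * q) = 0.
Proof.
by move=> ed hp; rewrite /point_form big1 // => z _; rewrite (pihomog_mull_gt _ ed hp) meval0.
Qed.

(** Multiples by monomials of degree above [e] are killed anyway. Finitely many tests remain, so
    that apolarity becomes the boolean predicate [apolarb]. *)
Lemma point_form_ext i p :
  (forall m : 'X_{1..n < e.+1}, point_form i (p * 'X_[m]) = 0) ->
  forall g, point_form i (p * g) = 0.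
Proof.
move=> H; elim/mpolyind=> [|c m q _ _ IH]; first by rewrite mulr0 point_form0.
rewrite mulrDr -scalerAr point_formP IH addr0.
have [me|me] := ltnP e (mdeg m).
  by rewrite [p * _]mulrC (point_form_gt _ _ me) ?mulr0 ?dhomogX.
by rewrite (H (BMultinom (me : mdeg m < e.+1)%N)) mulr0.
Qed.

Definition apolar (p : R) : Prop := forall i g, point_form i (p * g) = 0.

Definition apolarb : {pred R} := fun p =>
  [forall i, forall m : 'X_{1..n < e.+1}, point_form i (p * 'X_[m]) == 0].

Lemma apolarP p : reflect (apolar p) (p \in apolarb).
Proof.
apply: (iffP forallP) => [H i g|H i].
  by apply: point_form_ext => m; apply/eqP; move/forallP: (H i).
by apply/forallP=> m; rewrite H.
Qed.

(** A nonzero functional keeps 1 out, as the ideal has to be proper. *)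
Lemma apolar_closed : (exists i g, point_form i g != 0) -> idealr_closed apolarb.
Proof.
move=> [i [g gi]]; split.
- by apply/apolarP => j q; rewrite mul0r point_form0.
- by apply/apolarP => /(_ i g); rewrite mul1r => /eqP; rewrite (negPf gi).
move=> a u v /apolarP hu /apolarP hv; apply/apolarP => j q.
by rewrite mulrDl -[a * u * q]scale1r point_formP -mulrA mulrCA hu hv mulr0 addr0.
Qed.

Lemma apolar_ideal : (exists i g, point_form i g != 0) ->
  exists I : idealr R, forall p, p \in I <-> apolar p.
Proof.
move=> /apolar_closed cl; pose build := isIdealr.Build R apolarb cl.
pose I : idealr R := HB.pack apolarb build.
by exists I => p; split=> /apolarP.
Qed.

Section Ideal.
Variables (I : idealr R) (IP : forall p, p \in I <-> apolar p).

(** Testing the part of degree [d] of [p] against [g] amounts to testing [p] against the part of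
    degree [e - d] of [g]. *)
Lemma apolar_homogeneous : homogeneous_ideal I.
Proof.
move=> p /IP pI d; apply/IP => i g; have [ed|de] := ltnP e d.
  exact: point_form_gt ed (pihomogP _ _ _).
have dj := subnKC de; rewrite (point_form_mul _ _ dj (pihomogP _ _ _)).
rewrite -[RHS](pI i (pihomog mdeg (e - d) g)); apply: eq_bigr => z _.
have -> : pihomog mdeg e (p * pihomog mdeg (e - d) g) =
    pihomog mdeg (e - d) g * pihomog mdeg d p.
  by rewrite mulrC -(pihomog_mull d p (pihomogP _ _ _)) subnK.
by rewrite mevalM mulrC.
Qed.

Lemma apolar_gt d p : (e < d)%N -> p \is d.-homog -> p \in I.
Proof. by move=> ed hp; apply/IP => i g; apply: point_form_gt ed hp. Qed.

(** A representative [p] of a socle element is congruent to its part of degree [e]: the test by 1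
    sees only that part, and a monomial divisible by [X_l] kills [p] because ['X_l * p] lies in [I],
    and the part of degree [e] for degree reasons. *)
Lemma apolar_level : level I e.
Proof.
move=> a soc; pose p := repr a; have aE : a = \pi_{ideal_quot I} p by rewrite reprK.
have xp l : 'X_l * p \in I.
  apply/piI; rewrite rmorphM /= -aE; apply: soc.
  exists (fun j => (j == l)%:R); rewrite (bigD1 l) //= eqxx mul1r big1 ?addr0 //.
  by move=> j /negPf->; rewrite mul0r.
exists (pihomog mdeg e p); first exact: pihomogP.
rewrite aE; apply/eqP; rewrite -Quotient.idealrBE; apply/IP => i.
apply: point_form_ext => m; have [->|m0] := eqVneq (bmnm m) 0%MM.
  rewrite mpolyX0 mulr1 /point_form big1 // => z _.
  by rewrite linearB /= pihomog_id subrr meval0.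
have [l [m' Em]] := mnm_split (elimN eqP m0).
rewrite mulrBl -scaleN1r addrC point_formP.
rewrite {2}Em mpolyXD mulrA [p * _]mulrC; have /IP -> := xp l; rewrite addr0.
rewrite (point_form_mul _ _ (addn0 e) (pihomogP _ _ _)) big1 ?mulr0 // => z _.
rewrite pihomogX ifN ?meval0 ?mulr0 // mdeg_eq0; exact: m0.
Qed.

Let N := #|{: 'X_{1..n < e.+1}}|.
Let N' := #|{: 'I_t * 'X_{1..n < e.+1}}|.

(** The matrix [E] collects the finitely many tests on monomials of degree at most [e]. The identity
    as [T] gives A, and [pihomog mdeg i] gives A_i. *)
Lemma apolar_has_dim (T : R -> R) (S : {ideal_quot I} -> Prop) :
  (forall a p q, T (a *: p + q) = a *: T p + T q) ->
  (forall x, S x <-> exists2 p, (msize p <= e.+1)%N & x = \pi_{ideal_quot I} (T p)) ->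
  exists d, has_dim S d.
Proof.
move=> TP SP.
pose mon (j : 'I_N) : R := 'X_[bmnm (enum_val j)].
pose v (j : 'I_N) := \pi_{ideal_quot I} (T (mon j)).
pose E := \matrix_(j < N, l < N') point_form (enum_val l).1
  (T (mon j) * 'X_[bmnm (enum_val l).2]).
have vE c : combination v c = \pi_{ideal_quot I} (T (combination mon c)).
  rewrite (combination_map (g := fun p => \pi_{ideal_quot I} (T p))) // => a p q.
  by rewrite TP rmorphD /= pi_scale.
exists (\rank E); apply: (@has_dim_rank _ _ _ _ v E).
  have E_E c l : (c *m E) 0 l = point_form (enum_val l).1
      (T (combination mon c) * 'X_[bmnm (enum_val l).2]).
    rewrite mxE (combination_map (W := k^o) (g := fun p => point_form (enum_val l).1
      (T p * 'X_[bmnm (enum_val l).2]))).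
      by apply: eq_bigr => j _; rewrite [E _ _]mxE.
    by move=> a p q; rewrite TP mulrDl -scalerAl point_formP.
  move=> c; rewrite vE; split=> [/piI/IP H|H].
    by apply/rowP=> l; rewrite E_E H mxE.
  apply/piI/IP => i; apply: point_form_ext => m.
  by have := E_E c (enum_rank (i, m)); rewrite H enum_rankK mxE => <-.
move=> x; split=> [/SP[p pe ->]|[c ->]].
  exists (\row_j p@_(bmnm (enum_val j))); rewrite vE; congr (\pi_ _ (T _)).
  rewrite {1}(mpolywE pe) /combination (reindex (fun j : 'I_N => enum_val j)) /=.
    by apply: eq_bigr => j _; rewrite mxE.
  exact/onW_bij/enum_val_bij.
apply/SP; exists (combination mon c) => //.
apply: (big_ind (fun p : R => msize p <= e.+1)%N) => [|p q hp hq|j _].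
- by rewrite msize0.
- by apply: leq_trans (msizeD_le _ _) _; rewrite geq_max hp hq.
- apply: leq_trans (msizeZ_le _ _) _; rewrite msizeX; exact: bmdeg.
Qed.

Lemma apolar_component_dim i : exists d, has_dim (@component k n I i) d.
Proof.
apply: (@apolar_has_dim (pihomog mdeg i)) => [a p q|x]; first by rewrite linearP.
split=> [[p hp ->]|[p _ ->]]; last by exists (pihomog mdeg i p) => //; apply: pihomogP.
have [ei|ie] := ltnP e i.
  exists 0; first by rewrite msize0.
  by rewrite linear0 rmorph0; apply/piI/(apolar_gt ei hp).
exists p; last by rewrite pihomog_dE.
rewrite mmeasureE; apply/bigmax_leqP_seq => m mp _.
by rewrite (dhomogP _ _ _ hp).
Qed.

Lemma apolar_finite_dim : exists d, has_dim (fun _ : {ideal_quot I} => True) d.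
Proof.
apply: (@apolar_has_dim id) => // x; split=> // _.
suff [p pe px] : exists2 p : R, (msize p <= e.+1)%N & repr x - p \in I.
  exists p => //; rewrite -[x]reprK; apply/eqP.
  by rewrite -Quotient.idealrBE.
elim/mpolyind: (repr x) => [|c m p _ _ [p' p'e pp']].
  by exists 0; rewrite ?msize0 ?subr0 ?rpred0.
have [em|me] := ltnP e (mdeg m); last first.
  exists (c *: 'X_[m] + p'); last by rewrite opprD addrACA subrr add0r.
  apply: leq_trans (msizeD_le _ _) _; rewrite geq_max p'e andbT.
  by apply: leq_trans (msizeZ_le _ _) _; rewrite msizeX.
exists p' => //; rewrite -addrA rpredD //; apply: (apolar_gt em).
by rewrite rpredZ // dhomogX.
Qed.

End Ideal.
End PointFunctionals.

(** * Hilbert functions of ideals apolar to grids of points *)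

Section GridPoints.
Local Open Scope ring_scope.
Local Open Scope quotient_scope.
Variables (k : fieldType) (c : nat -> k) (q t e B : nat) (Z : finType).
Variables (s : Z -> 'I_t) (a : Z -> 'I_q.+2 -> nat).
Hypotheses (c_inj : injective c) (c0 : c 0%N = 0).
Hypothesis a_lt : forall z l, (a z l < B)%N.
Hypothesis a_inj : forall z w, s z = s w -> (forall l, a z l = a w l) -> z = w.
Local Notation R := {mpoly k[q.+3]}.

(* Piece i uses the coordinates c (B i), ..., c (B i + B - 1), so that distinct
   pieces are disjoint; coordinate 0 of every point is 1. *)
Definition grid_coord (i b : nat) : k := c (B * i + b)%N.

Definition grid_point (z : Z) (i : 'I_q.+3) : k :=
  if unlift ord0 i is Some l then grid_coord (s z) (a z l) else 1.

Local Notation P := grid_point.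

Lemma grid_coord_inj i b j d : (b < B)%N -> (d < B)%N ->
  grid_coord i b = grid_coord j d -> i = j /\ b = d.
Proof.
move=> bB dB /c_inj E; have B0 : (0 < B)%N by apply: leq_ltn_trans bB.
have : ((B * i + b) %/ B = (B * j + d) %/ B)%N by rewrite E.
rewrite ![(B * _)%N]mulnC !divnMDl // !divn_small // !addn0 => ij.
by split=> //; apply/eqP; move/eqP: E; rewrite ij eqn_add2l.
Qed.

Lemma grid_point0 z : P z ord0 = 1.
Proof. by rewrite /P unlift_none. Qed.

Lemma grid_pointS z l : P z (lift ord0 l) = grid_coord (s z) (a z l).
Proof. by rewrite /P liftK. Qed.

Lemma grid_point_sep z w : z != w -> exists i, P z i != P w i.
Proof.
move=> zw; apply: NNPP => nex; case/eqP: zw.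
have eqP' l : P z l = P w l.
  by apply/eqP; apply: contra_notT nex => ?; exists l.
have E l : nat_of_ord (s z) = s w /\ a z l = a w l.
  by apply: grid_coord_inj => //; rewrite -!grid_pointS.
by apply: a_inj => [|l]; [apply: val_inj; apply: (E ord0).1 | apply: (E l).2].
Qed.

Lemma dhomog_bigprod (T : finType) (Q : pred T) (F : T -> R) (d : T -> nat) :
  (forall x, Q x -> F x \is (d x).-homog) ->
  \prod_(x | Q x) F x \is (\sum_(x | Q x) d x)%N.-homog.
Proof.
move=> H; apply: (big_rec2 (fun (p : R) (m : nat) => p \is m.-homog)).
  exact: dhomog1.
by move=> x m p Qx hp; apply: dhomogM => //; apply: H.
Qed.

Lemma dhomog_line (i : 'I_q.+3) (b : k) : 'X_i - b *: 'X_ord0 \is 1.-homog.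
Proof. by rewrite rpredB ?rpredZ // dhomogX /= mdeg1. Qed.

(** For each other point one linear factor vanishes there and not at [z]. The variable [X_0], equal
    to 1 at all points, pads the degree. *)
Lemma indicator_poly z d : (#|Z|.-1 <= d)%N ->
  exists2 p : R, p \is d.-homog & forall w, (p.@[P w] != 0) = (w == z).
Proof.
move=> Zd.
have ex w : exists i, w != z -> P z i != P w i.
  case: (boolP (w != z)) => [|_]; last by exists ord0.
  by rewrite eq_sym => /grid_point_sep [i ?]; exists i.
pose sep w := proj1_sig (constructive_indefinite_description _ (ex w)).
have sepP w : w != z -> P z (sep w) != P w (sep w).
  exact: proj2_sig (constructive_indefinite_description _ (ex w)).
exists ((\prod_(w | w != z) ('X_(sep w) - P w (sep w) *: 'X_ord0)) *
    'X_ord0 ^+ (d - #|Z|.-1)).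
  rewrite -[d in d.-homog](subnKC Zd); apply: dhomogM; last exact: dhomog_powX.
  have -> : #|Z|.-1 = (\sum_(w | w != z) 1)%N.
    by rewrite sum1_card -(cardC1 z); apply: eq_card.
  by apply: dhomog_bigprod => w _; apply: dhomog_line.
move=> w; rewrite mevalM rmorphXn /= mevalXU grid_point0 expr1n mulr1.
rewrite rmorph_prod /=.
have ev w' v : ('X_(sep w') - P w' (sep w') *: 'X_ord0).@[P v] =
    P v (sep w') - P w' (sep w').
  by rewrite mevalB mevalZ !mevalXU grid_point0 mulr1.
have [->|wz] := eqVneq w z.
  by apply/prodf_neq0 => w' w'z; rewrite ev subr_eq0 sepP.
by apply/negbTE; rewrite negbK; apply/prodf_eq0; exists w; rewrite // ev subrr.
Qed.

Definition grid_deg z := (\sum_l a z l)%N.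

(** The factors vanish where coordinate [l] has an index [b < a w l]; again [X_0] pads the
    degree. *)
Lemma newton_poly w d : (grid_deg w <= d)%N ->
  exists2 p : R, p \is d.-homog & forall z, s z = s w ->
    (p.@[P z] != 0) = [forall l, (a w l <= a z l)%N].
Proof.
move=> wd.
exists ((\prod_l \prod_(b < a w l)
  ('X_(lift ord0 l) - grid_coord (s w) b *: 'X_ord0)) * 'X_ord0 ^+ (d - grid_deg w)).
  rewrite -[d in d.-homog](subnKC wd); apply: dhomogM; last exact: dhomog_powX.
  apply: dhomog_bigprod => l _.
  rewrite -[a w l in X in X.-homog]card_ord -sum1_card.
  by apply: dhomog_bigprod => b _; apply: dhomog_line.
move=> z szw; rewrite mevalM rmorphXn /= mevalXU grid_point0 expr1n mulr1.
rewrite rmorph_prod /=.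
have ev l b : ('X_(lift ord0 l) - grid_coord (s w) b *: 'X_ord0).@[P z] =
    grid_coord (s w) (a z l) - grid_coord (s w) b.
  by rewrite mevalB mevalZ !mevalXU grid_point0 mulr1 grid_pointS szw.
apply/prodf_neq0/forallP => [H l|H l _].
  rewrite leqNgt; apply/negP => lt; move: (H l isT).
  rewrite rmorph_prod /= => /prodf_neq0 /(_ (Ordinal lt) isT).
  by rewrite ev subrr eqxx.
rewrite rmorph_prod /=; apply/prodf_neq0 => b _; rewrite ev subr_eq0.
apply/eqP => /grid_coord_inj [||_ E] //; first exact: ltn_trans (ltn_ord b) (a_lt _ _).
by have := H l; rewrite E leqNgt ltn_ord.
Qed.

Variables (I : idealr R) (IP : forall p, p \in I <-> apolar e s P p).
Variables (h : nat -> nat) (H : hilbert_function I h).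

(* The Newton polynomials of the points zeta x are unitriangular, up to scaling,
   with respect to the order on exponents. *)
Lemma grid_lower_bound (K : finType) (zeta : K -> Z) i j :
  (i + j)%N = e -> (#|Z|.-1 <= i)%N -> injective zeta ->
  (forall x, (grid_deg (zeta x) <= j)%N) -> (#|K| <= h i)%N.
Proof.
move=> ij Zi zinj zdeg.
have exp x : exists p : R,
    p \is i.-homog /\ forall w, (p.@[P w] != 0) = (w == zeta x).
  by have [p] := indicator_poly (zeta x) Zi; exists p.
pose p x := proj1_sig (constructive_indefinite_description _ (exp x)).
have pP x : p x \is i.-homog /\ forall w, ((p x).@[P w] != 0) = (w == zeta x).
  exact: proj2_sig (constructive_indefinite_description _ (exp x)).
apply: (card_independent_le (b := fun x => \pi_{ideal_quot I} (p x))
  (component_subspace I i) (H i)) => [x|d sum0].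
  by exists (p x) => //; apply: (pP x).1.
pose f := \sum_x d x *: p x.
have fI : f \in I.
  apply/piI; rewrite -[RHS]sum0 rmorph_sum; apply: eq_bigr => x _; exact: pi_scale.
have fhom : f \is i.-homog by apply: rpred_sum => x _; apply: rpredZ; apply: (pP x).1.
have fev z : f.@[P z] = \sum_x d x * (p x).@[P z].
  by rewrite rmorph_sum /=; apply: eq_bigr => x _; rewrite mevalZ.
move=> x0; apply/eqP; case: (boolP (d x0 == 0)) => // dx0.
(* Among the points with nonzero coefficient, [zeta y] has largest degree. Its Newton polynomial [g]
   vanishes at the others in its piece, so testing [f] against [g] isolates the coefficient of
   [y]. *)
have [y dy ymax] :=
  @arg_maxnP _ x0 (fun x => d x != 0) (fun x => grid_deg (zeta x)) dx0.
have [g ghom gP] := newton_poly (zdeg y).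
have := (IP f).1 fI (s (zeta y)) g; rewrite (point_form_mul _ _ _ _ ij fhom).
rewrite (pihomog_dE ghom) (bigD1 (zeta y)) //= big1 => [|z /andP[/eqP sz zy]].
  rewrite addr0 => /eqP; rewrite mulf_eq0 fev (bigD1 y) //= big1 => [|x xy].
    rewrite addr0 mulf_eq0 (negPf dy) /= -[_ == 0 in X in X || _]negbK (pP y).2 eqxx /=.
    by rewrite -[_ == 0]negbK gP //; case/negP; apply/forallP.
  apply/eqP; rewrite mulf_eq0; apply/orP; right.
  by rewrite -[_ == 0]negbK (pP x).2 inj_eq // eq_sym.
apply/eqP; rewrite mulf_eq0; apply/orP.
case: (boolP (g.@[P z] == 0)) => [_|]; first by right.
rewrite gP // => /forallP le; left; rewrite fev big1 // => x _.
apply/eqP; rewrite mulf_eq0; case: (boolP (d x == 0)) => //= dx.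
rewrite -[_ == 0]negbK (pP x).2; apply: contra zy => /eqP zE.
apply/eqP/a_inj => // l; symmetry; apply/eqP.
(* A point that dominates [zeta y] in every coordinate without exceeding its degree equals it. *)
have [le1 /esym] : (grid_deg (zeta y) <= grid_deg z ?= iff
    [forall (l | true), a (zeta y) l == a z l])%N.
  by apply: leqif_sum => l' _; split=> //; apply: le.
by rewrite eqn_leq le1 zE (ymax x dx : (_ <= _)%N) /= => /forallP /(_ l).
Qed.

Lemma grid_zero i : (e < i)%N -> h i = 0%N.
Proof.
move=> ei; apply/eqP; rewrite -leqn0 -card_void.
apply: (has_dim_le_functionals (f := \pi_{ideal_quot I}) (F := fun (x : void) p => 0)
  (T := fun p => p \is i.-homog) _ _ _ _ _ (component_subspace I i) (H i)).
- by move=> x p p'; rewrite rmorphD /= pi_scale.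
- by case.
- by split=> [|x p p' hp hp']; rewrite ?rpred0 // rpredD ?rpredZ.
- by move=> _ [p hp ->]; exists p.
- by move=> p hp _; apply/piI/(apolar_gt IP ei hp).
Qed.

Lemma grid_upper_functionals i (K : finType) (F : K -> R -> k) :
  (forall x d p p', F x (d *: p + p') = d * F x p + F x p') ->
  (forall p, p \is i.-homog -> (forall x, F x p = 0) -> p \in I) ->
  (h i <= #|K|)%N.
Proof.
move=> FP ker.
apply: (has_dim_le_functionals (f := \pi_{ideal_quot I}) (F := F)
  (T := fun p => p \is i.-homog) _ _ _ _ _ (component_subspace I i) (H i)).
- by move=> x p p'; rewrite rmorphD /= pi_scale.
- exact: FP.
- by split=> [|x p p' hp hp']; rewrite ?rpred0 // rpredD ?rpredZ.
- by move=> _ [p hp ->]; exists p.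
- by move=> p hp F0; apply/piI/ker.
Qed.

(** In degree [e] only constant multiples matter, so the [t] functionals themselves decide
    membership in [I]. *)
Lemma grid_upper_top : (h e <= t)%N.
Proof.
rewrite -[t in (_ <= t)%N]card_ord.
apply: (grid_upper_functionals (F := point_form e s P)) => [i d p p'|p hp F0].
  exact: point_formP.
apply/IP => i; apply: point_form_ext => m.
rewrite (point_form_mul _ _ _ _ (addn0 e) hp) pihomogX.
case: eqP => [/eqP|_]; last by rewrite big1 // => z _; rewrite meval0 mulr0.
rewrite mdeg_eq0 => /eqP ->; rewrite mpolyX0 -[RHS](F0 i).
by apply: eq_bigr => z _; rewrite meval1 mulr1 pihomog_dE.
Qed.

(* On Z0 a form of degree j restricts to a combination of the products
   x_1^b x_2^d with b + d <= j; the other points contribute one condition each. *)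
Lemma grid_upper_bound (Z0 : pred Z) (K : finType) (rho : K -> Z)
    (L : seq (nat * nat)) (s0 : 'I_t) i j :
  (i + j)%N = e -> s0 = 0%N :> nat ->
  (forall z, z \in Z0 -> s z = s0) ->
  (forall z (l : 'I_q.+2), z \in Z0 -> (1 < l)%N -> a z l = 0%N) ->
  (forall z, z \notin Z0 -> exists x, z = rho x) ->
  (forall b d, (b + d <= j)%N -> (b, d) \in L) ->
  (h i <= size L + #|K|)%N.
Proof.
move=> ij s00 Z0s Z0a Z0c Lj; rewrite -[size L]card_ord -card_sum.
pose x1 : 'I_q.+3 := lift ord0 ord0.
pose x2 : 'I_q.+3 := lift ord0 (lift ord0 ord0).
pose F (y : 'I_(size L) + K) (p : R) : k := match y with
  | inl l => let bd := nth (0, 0)%N L l in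
      \sum_(z in Z0) p.@[P z] * (P z x1 ^+ bd.1 * P z x2 ^+ bd.2)
  | inr x => p.@[P (rho x)]
  end.
apply: (grid_upper_functionals (F := F)) => [[l|x] d p p'|p hp F0] /=.
- rewrite mulr_sumr -big_split; apply: eq_bigr => z _.
  by rewrite /= mevalD mevalZ mulrDl -mulrA.
- by rewrite mevalD mevalZ.
apply/IP => i'; apply: point_form_ext => m.
rewrite (point_form_mul _ _ _ _ ij hp) pihomogX.
case: eqP => [mj|_]; last by rewrite big1 // => z _; rewrite meval0 mulr0.
rewrite (bigID (mem Z0)) /= [X in _ + X]big1 ?addr0 => [|z /andP[_ /Z0c[x ->]]]; last first.
  by have /= -> := F0 (inr x); rewrite mul0r.
have [->|ne] := eqVneq i' s0; last first.
  by rewrite big_pred0 // => z; apply/andP => -[/eqP sz /Z0s sz']; rewrite -sz sz' eqxx in ne.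
have ml : (m x1 + m x2 <= j)%N.
  have <- : mdeg m = j by [].
  by rewrite mdegE (bigD1 x1) //= (bigD1 x2) //= addnA leq_addr.
have [l lt lE] := nthP (0, 0)%N (Lj _ _ ml).
have := F0 (inl (Ordinal lt)); rewrite /= lE /= => S0.
(* The remaining coordinates are 0 on [Z0], so the other variables of [m] contribute a common
   factor, 0 or 1. *)
pose kap : k := \prod_(l' < q) (0 ^+ m (lift ord0 (lift ord0 (lift ord0 l')))).
transitivity ((\sum_(z in Z0) p.@[P z] * (P z x1 ^+ m x1 * P z x2 ^+ m x2)) * kap).
  rewrite mulr_suml; apply: eq_big => [z|z /andP[_ zZ0]].
    by case: (boolP (z \in Z0)) => [/Z0s->|]; rewrite ?eqxx ?andbF.
  rewrite -mulrA; congr (_ * _); rewrite mevalX !big_ord_recl grid_point0 expr1n mul1r.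
  rewrite mulrA; congr (_ * _); apply: eq_bigr => l' _; congr (_ ^+ _).
  by rewrite grid_pointS (Z0s z zZ0) s00 (Z0a z) // /grid_coord muln0 c0.
by rewrite S0 mul0r.
Qed.

(** Indicator polynomials of degree e - 1 force a linear form in [I] to vanish at every point; the
    origin and the unit points of piece 0 then annihilate its coefficients. *)
Lemma grid_no_linear (o : Z) (u : 'I_q.+2 -> Z) : (#|Z| <= e)%N ->
  s o = 0%N :> nat -> (forall l, a o l = 0%N) ->
  (forall l, s (u l) = s o) -> (forall l l', a (u l) l' = (l' == l)) ->
  forall p : R, p \is 1.-homog -> p \in I -> p = 0.
Proof.
move=> Ze so ao su au p hp pI.
have Z0 : (0 < #|Z|)%N by apply/card_gt0P; exists o.
have p0 z : p.@[P z] = 0.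
  have Ze1 : (#|Z|.-1 <= e.-1)%N by lia.
  have e1 : (1 + e.-1)%N = e by lia.
  have [g hg gP] := indicator_poly z Ze1.
  have := (IP p).1 pI (s z) g.
  rewrite (point_form_mul _ _ _ _ e1 hp) (bigD1 z) //= big1 => [|w /andP[_ /negPf wz]].
    rewrite addr0 pihomog_dE // => /eqP; rewrite mulf_eq0 => /orP [/eqP //|].
    by rewrite -[_ == 0]negbK gP eqxx.
  by rewrite pihomog_dE //; apply/eqP; rewrite mulf_eq0 -[X in _ || X]negbK gP wz orbT.
have [f pE] : exists f : 'I_q.+3 -> k, p = \sum_i f i *: 'X_i.
  move: p hp {pI p0}; apply: dhomog_ind => [|d p p' [f ->] [f' ->]|m /eqP/mdeg1P[i /eqP->]].
  - by exists (fun=> 0); rewrite big1 // => i _; rewrite scale0r.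
  - exists (fun i => d * f i + f' i); rewrite scaler_sumr -big_split.
    by apply: eq_bigr => i _; rewrite scalerDl scalerA.
  - exists (fun j => (j == i)%:R); rewrite (bigD1 i) //= eqxx scale1r big1 ?addr0 //.
    by move=> j /negPf->; rewrite scale0r.
have ev z : p.@[P z] = f ord0 + \sum_l f (lift ord0 l) * grid_coord (s z) (a z l).
  rewrite pE rmorph_sum big_ord_recl /= mevalZ mevalXU grid_point0 mulr1.
  by congr (_ + _); apply: eq_bigr => l _; rewrite mevalZ mevalXU grid_pointS.
have f0 : f ord0 = 0.
  rewrite -[RHS](p0 o) ev big1 ?addr0 // => l _.
  by rewrite ao so /grid_coord muln0 c0 mulr0.
have fS l : f (lift ord0 l) = 0.
  have := p0 (u l); rewrite ev f0 add0r (bigD1 l) //= big1 => [|l' /negPf l'l].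
    rewrite addr0 su so au eqxx /grid_coord muln0 => /eqP.
    by rewrite mulf_eq0 -[X in _ || (_ == X)]c0 (inj_eq c_inj) orbF => /eqP.
  by rewrite su so au l'l /grid_coord muln0 c0 mulr0.
rewrite pE big_ord_recl f0 scale0r add0r big1 // => l _.
by rewrite fS scale0r.
Qed.

End GridPoints.

(** * Configurations of points *)

(** Log-concavity fails at [e - j.+1]: the neighbours [h (e - j.+2)] and [h (e - j)] are at least
    [#|Z|] and [#|K|], while the middle value is at most [size L + #|K'|]. *)
Lemma grid_not_log_concave (k : fieldType) (q t j B : nat) (Z : finType)
    (s : Z -> 'I_t) (a : Z -> 'I_q.+2 -> nat) (s0 : 'I_t) (K : finType) (zeta : K -> Z)
    (Z0 : pred Z) (K' : finType) (rho : K' -> Z) (L : seq (nat * nat)) :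
  infinite_field k ->
  (forall z l, a z l < B) ->
  (forall z w, s z = s w -> (forall l, a z l = a w l) -> z = w) ->
  s0 = 0 :> nat ->
  (forall i, exists z, s z = i /\ forall l, a z l = 0) ->
  (forall l, exists z, s z = s0 /\ forall l', a z l' = (l' == l)) ->
  (forall z, grid_deg a z <= j.+2) ->
  injective zeta -> (forall x, grid_deg a (zeta x) <= j) ->
  (forall z, z \in Z0 -> s z = s0) ->
  (forall z (l : 'I_q.+2), z \in Z0 -> 1 < l -> a z l = 0) ->
  (forall z, z \notin Z0 -> exists x, z = rho x) ->
  (forall b d, b + d <= j.+1 -> (b, d) \in L) ->
  (size L + #|K'|) ^ 2 < #|K| * #|Z| ->
  ~ all_level_log_concave k q.+3 t.
Proof.
move=> kinf a_lt a_inj s00 exo exu zdeg zinj kdeg Z0s Z0a Z0c Lj num lc.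
have [org orgP] := choice _ exo; have [u uP] := choice _ exu.
have so i := (orgP i).1; have ao i := (orgP i).2.
have su l := (uP l).1; have au l := (uP l).2.
have [c c_inj c0] := infinite_field_inj kinf.
(* This [e] makes [e - j.+2] equal to [#|Z|], so indicator polynomials exist in all degrees used. *)
pose P := grid_point c B s a; pose e := #|Z| + j.+2.
have Z1 : 0 < #|Z| by apply/card_gt0P; exists (org s0).
have [I IP] : exists I : idealr {mpoly k[q.+3]}, forall p, p \in I <-> apolar e s P p.
  apply: apolar_ideal; pose z := org s0.
  have ez : #|Z|.-1 <= e by rewrite /e; lia.
  have [p hp pP] := indicator_poly c_inj a_lt a_inj z ez.
  exists (s z), p; rewrite /point_form (bigD1 z) //= pihomog_dE // big1 => [|w /andP[_ /negPf wz]].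
    by rewrite addr0 pP eqxx.
  by apply/eqP; rewrite -[_ == _]negbK pP wz.
have exH i : exists d, has_dim (@component k q.+3 I i) d.
  exact: apolar_component_dim IP i.
pose h i := proj1_sig (constructive_indefinite_description _ (exH i)).
have H : hilbert_function I h.
  by move=> i; exact: proj2_sig (constructive_indefinite_description _ (exH i)).
have lower := grid_lower_bound c_inj a_lt a_inj IP H.
have he : h e = t.
  apply/eqP; rewrite eqn_leq (grid_upper_top IP H) /= -{1}[t]card_ord.
  (* The origins, one in each piece, have degree 0. *)
  apply: (lower _ org e 0); rewrite ?addn0 //.
  - by rewrite /e; lia.
  - exact: can_inj so.
  - by move=> i; rewrite /grid_deg big1.
have lev : level_hilbert_function k q.+3 t h.
  exists I; split=> //.
    split.
    - exact: apolar_homogeneous IP.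
    - move=> p hp pI; apply: (grid_no_linear (o := org s0) (u := u)
        c_inj c0 a_lt a_inj IP _ _ _ _ _ hp pI).
      + by rewrite /e leq_addr.
      + by rewrite so; exact: s00.
      + by move=> l; exact: ao.
      + by move=> l; rewrite so; exact: su.
      + exact: au.
    - exact: apolar_finite_dim IP.
  exists e; split=> //; last exact: apolar_level IP.
  split; first by rewrite he (leq_ltn_trans _ (ltn_ord s0)).
  by move=> i; exact: (grid_zero IP H).
have e1 : 0 < #|Z|.+1 by [].
have := lc h lev #|Z|.+1 e1; apply/negP; rewrite -ltnNge.
have ub := grid_upper_bound c0 IP H _ s00 Z0s Z0a Z0c Lj.
apply: leq_ltn_trans (_ : _ <= (size L + #|K'|) ^ 2) (leq_trans num _).
  by rewrite leq_exp2r //; apply: ub; rewrite /e; lia.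
rewrite mulnC; apply: leq_mul.
  by apply: (lower _ id _ j.+2) => //; rewrite /e /=; lia.
by apply: (lower _ zeta _ j) => //; rewrite /e; lia.
Qed.

Lemma sum_nth_le (r : seq nat) n : \sum_(l < n) nth 0 r l <= sumn r.
Proof.
elim: r n => [|x r IH] n; first by rewrite big1 // => l _; rewrite nth_nil.
case: n => [|n]; first by rewrite big_ord0.
by rewrite big_ord_recl /= leq_add2l; apply: IH.
Qed.

(* A row [s; a_0; a_1; ...] is the point of piece s with exponents a_0, a_1, ....
   The rows in L0 and L2 form a plane grid, those in L2 having degree j + 1 or
   j + 2; all others have degree at most j.  The w extra unit points in piece 0
   and the v extra one-point pieces raise the codimension and the type. *)
Section Rows.
Variables (q0 t0 w v j : nat) (L0 L1 L2 : seq (seq nat)) (L : seq (nat * nat)).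
Let M := L0 ++ L1 ++ L2.
Hypothesis M_wf : all (fun r => [&& size r == q0.+3, head 0 r <= t0,
  all (fun x => x < j.+3) (behead r) & sumn (behead r) <= j.+2]) M.
Hypothesis M_uniq : uniq M.
Hypothesis M_origin : forall i, i <= t0 -> i :: nseq q0.+2 0 \in M.
Hypothesis M_unit : forall l, l < q0.+2 ->
  0 :: mkseq (fun l' => (l' == l : nat)) q0.+2 \in M.
Hypothesis low : all (fun r => sumn (behead r) <= j) (L0 ++ L1).
Hypothesis plane : all (fun r => (head 0 r == 0) && all (pred1 0) (drop 3 r)) (L0 ++ L2).
Hypothesis LP : forall b d, b + d <= j.+1 -> (b, d) \in L.
Hypothesis j0 : 0 < j.
(** Here [x] stands for the number [w + v] of extra points, which enter all three counts. *)
Hypothesis num : forall x,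
  (size L + (size L1 + x)) ^ 2 < (size (L0 ++ L1) + x) * (size M + x).

Let q := q0 + w.
Let t := t0 + v.
Let Z : finType := ('I_(size M) + ('I_w + 'I_v))%type.
Let row (i : nat) := nth [::] M i.

Let s (z : Z) : 'I_t.+1 := match z with
  | inl i => inord (head 0 (row i))
  | inr (inl _) => ord0
  | inr (inr i) => inord (t0.+1 + i)
  end.

(** Reading past the end of a row returns 0, the value of its point in the [w] new coordinates. *)
Let a (z : Z) (l : 'I_q.+2) : nat := match z with
  | inl i => nth 0 (row i) l.+1
  | inr (inl i) => l == q0.+2 + i :> nat
  | inr (inr _) => 0
  end.

Lemma row_wf (i : 'I_(size M)) : [/\ size (row i) = q0.+3, head 0 (row i) <= t0,
  forall l, nth 0 (row i) l.+1 < j.+3 & sumn (behead (row i)) <= j.+2].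
Proof.
have /(all_nthP [::]) /(_ i (ltn_ord i)) /and4P [/eqP sz hd ent sm] := M_wf.
split=> // l; rewrite -nth_behead.
by have [/(all_nthP 0 ent)|/(nth_default 0) ->] := ltnP l (size (behead (row i))).
Qed.

Lemma extra_lt (i : 'I_w) : q0.+2 + i < q.+2.
Proof. by rewrite /q !addSn !ltnS ltn_add2l. Qed.

Lemma row_piece (i : 'I_(size M)) : s (inl i) = head 0 (row i) :> nat.
Proof. by have [_ hd _ _] := row_wf i; rewrite /= inordK // ltnS (leq_trans hd) ?leq_addr. Qed.

Lemma single_piece (i : 'I_v) : s (inr (inr i)) = t0.+1 + i :> nat.
Proof. by rewrite /= inordK // addSn ltnS ltn_add2l. Qed.

Lemma rows_inj z z' : s z = s z' -> (forall l, a z l = a z' l) -> z = z'.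
Proof.
pose kind (x : Z) := match x with inl _ => 0 | inr (inl _) => 1 | inr (inr _) => 2 end.
(* Ordering the three kinds of points leaves six of the nine cases. *)
wlog le_zz' : z z' / kind z <= kind z'.
  move=> W E az; case/orP: (leq_total (kind z) (kind z')) => le; first exact: W.
  by symmetry; apply: W.
case: z z' le_zz' => [i|[i|i]] [i'|[i'|i']] // _ /(congr1 val) /= E az.
- congr inl; apply/val_inj/eqP; 
  rewrite -(nth_uniq [::] (ltn_ord (i : 'I_(size M)))
    (ltn_ord (i' : 'I_(size M))) M_uniq).
  have [sz _ _ _] := row_wf i; have [sz' _ _ _] := row_wf i'.
  apply/eqP/(eq_from_nth (x0 := 0)); first by rewrite -/(row i) sz sz'.
  rewrite -/(row i) sz => -[_|l].
    by rewrite !nth0; move: E; rewrite -!/(s (inl _)) !row_piece.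
  rewrite !ltnS => lq; have lq' : l < q.+2 by rewrite /q; lia.
  exact: (az (Ordinal lq')).
- have := az (Ordinal (extra_lt i')); rewrite /= eqxx nth_default //.
  by have [-> _ _ _] := row_wf i; rewrite !addSn !ltnS leq_addr.
- move: E; have [_ hd _ _] := row_wf i.
  rewrite -/(s (inl i)) row_piece -/(s (inr (inr i'))) single_piece; lia.
- have := az (Ordinal (extra_lt i)); rewrite /= eqxx; case: eqP => // /addnI ii _.
  by congr (inr (inl _)); apply: val_inj.
- by move: E; rewrite -/(s (inr (inr i'))) single_piece.
- congr (inr (inr _)); apply: val_inj; apply: (@addnI t0.+1).
  by rewrite -!single_piece.
Qed.

Theorem rows_not_log_concave (k : fieldType) : infinite_field k ->
  ~ all_level_log_concave k q.+3 t.+1.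
Proof.
move=> kinf.
have idx r : r \in M -> exists i : 'I_(size M), row i = r.
  by move/(nthP [::]) => [i lt rE]; exists (Ordinal lt).
have deg_row (i : 'I_(size M)) : grid_deg a (inl i) <= sumn (behead (row i)).
  apply: leq_trans (sum_nth_le _ q.+2); apply: leq_sum => l _.
  by rewrite nth_behead.
have deg_extra (x : 'I_w + 'I_v) : grid_deg a (inr x) <= 1.
  case: x => i; rewrite /grid_deg /=; last by rewrite big1.
  rewrite (bigD1 (Ordinal (extra_lt i))) //= eqxx big1 // => l /negPf.
  by rewrite -val_eqE /= => ->.
pose rest (x : 'I_w + 'I_v) : Z := inr x.
have sz1 : size (L0 ++ L1) <= size M by rewrite /M catA [in X in _ <= X]size_cat leq_addr.
have sz2 (i : 'I_(size L1)) : size L0 + i < size M.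
  by rewrite /M !size_cat ltn_add2l (leq_trans (ltn_ord i)) ?leq_addr.
(* [zeta] lists points of degree at most [j], where the extra points qualify since [0 < j]; [rho]
   lists the points outside [Z0]. *)
pose zeta (x : 'I_(size (L0 ++ L1)) + ('I_w + 'I_v)) : Z :=
  match x with inl i => inl (widen_ord sz1 i) | inr x => rest x end.
pose rho (x : 'I_(size L1) + ('I_w + 'I_v)) : Z :=
  match x with inl i => inl (Ordinal (sz2 i)) | inr x => rest x end.
pose Z0 (z : Z) := if z is inl i then (i < size L0) || (size L0 + size L1 <= i) else false.
have Z0row (i : 'I_(size M)) : Z0 (inl i) ->
    (head 0 (row i) == 0) && all (pred1 0) (drop 3 (row i)).
  move=> /= iZ0; apply: (allP plane); rewrite mem_cat /row /M nth_cat.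
  case: ltnP iZ0 => /= [lt _|le iL]; first by rewrite mem_nth.
  rewrite nth_cat ifN; last by rewrite -leqNgt leq_subRL.
  apply/orP; right; apply: mem_nth; rewrite -subnDA ltn_subLR // -addnA.
  by rewrite -!size_cat.
apply: (@grid_not_log_concave k q t.+1 j j.+3 Z s a ord0 _ zeta Z0 _ rho L kinf) => //.
- case=> [i|[i|i]] l //=; first by have [_ _ -> _] := row_wf i.
  by case: (_ == _).
- exact: rows_inj.
- move=> i; have [it|ti] := leqP i t0.
    have [x xE] := idx _ (M_origin it); exists (inl x); split=> [|l].
      by apply: ord_inj; rewrite row_piece xE.
    by rewrite /a xE -[LHS]/(nth 0 (nseq q0.+2 0) l) nth_nseq if_same.
  have iv : i - t0.+1 < v by rewrite ltn_subLR //; apply: ltn_ord.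
  exists (inr (inr (Ordinal iv))); split=> //; apply: ord_inj.
  by rewrite single_piece /= subnKC.
- move=> l; have [lq|ql] := ltnP l q0.+2.
    have [x xE] := idx _ (M_unit lq); exists (inl x); split=> [|l'].
      by apply: ord_inj; rewrite row_piece xE.
    rewrite /a xE -val_eqE -[LHS]/(nth 0 (mkseq (fun l' => (l' == l : nat)) q0.+2) l').
    have [lt|ge] := ltnP l' q0.+2; first by rewrite nth_mkseq.
    by rewrite nth_default ?size_mkseq //; case: eqP => // E; move: lq; rewrite -E ltnNge ge.
  have lw : l - q0.+2 < w by rewrite ltn_subLR //; apply: ltn_ord.
  exists (inr (inl (Ordinal lw))); split=> // l' /=.
  by rewrite -val_eqE /= subnKC.
- case=> [i|x]; last by apply: leq_trans (deg_extra x) _.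
  by apply: leq_trans (deg_row i) _; have [] := row_wf i.
- case=> [i|x] [i'|x'] //=; last by case=> ->.
  by case=> ii; congr inl; apply: val_inj.
- case=> [i|x]; last exact: leq_trans (deg_extra x) _.
  apply: leq_trans (deg_row _) _; apply: (allP low).
  by rewrite /row /= /M catA nth_cat ltn_ord mem_nth.
- case=> [i|//] /Z0row /andP[/eqP hd _]; apply: ord_inj.
  by rewrite row_piece hd.
- case=> [i|//] l /Z0row /andP[_ /(all_nthP 0) dr] l1 /=.
  have l3 : 3 + (l - 2) = l.+1 by rewrite -[in RHS](subnKC l1).
  have [ls|sl] := ltnP (l - 2) (size (drop 3 (row i))).
    by have /eqP := dr _ ls; rewrite nth_drop l3.
  by rewrite nth_default //; move: sl; rewrite size_drop leq_subLR l3.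
- case=> [i|x _]; last by exists (inr x).
  rewrite /in_mem /= /Z0 negb_or -leqNgt -ltnNge => /andP[ge lt].
  have lt1 : i - size L0 < size L1 by rewrite ltn_subLR.
  exists (inl (Ordinal lt1)); congr inl; apply: ord_inj.
  by rewrite /= subnKC.
- by rewrite !card_sum !card_ord; apply: num.
Qed.

End Rows.

(** Exponents of the monomials in two variables of degrees m, ..., m + n - 1; [n] is the number of
    degrees. *)
Definition degree_pairs m n : seq (nat * nat) :=
  [seq (b, d - b) | d <- iota m n, b <- iota 0 d.+1].

Definition plane_rows (s : nat) (tl : seq nat) m n : seq (seq nat) :=
  [seq s :: bd.1 :: bd.2 :: tl | bd <- degree_pairs m n].

Lemma mem_degree_pairs n b d : b + d < n -> (b, d) \in degree_pairs 0 n.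
Proof.
move=> bd; apply/allpairsPdep; exists (b + d), b.
by rewrite !mem_iota !add0n ltnS leq_addr addKn.
Qed.

(* The 35 points off the plane complete the 21 plane points of degree at most 5
   to a tetrahedral grid; 35 > 28 = C(8,2). *)
Lemma not_log_concave_codim_ge4 (k : fieldType) (w v : nat) :
  infinite_field k -> ~ all_level_log_concave k w.+4 v.+1.
Proof.
move=> kinf; apply: (@rows_not_log_concave 1 0 w v 5
  (plane_rows 0 [:: 0] 0 6)
  (flatten [seq plane_rows 0 [:: c] 0 (6 - c) | c <- iota 1 5])
  (plane_rows 0 [:: 0] 6 2) (degree_pairs 0 7)) => //.
- by case.
- by case=> [|[|[|]]].
- by move=> b d bd; apply: mem_degree_pairs.
(* Here 56 = 21 + 35 and 71 = 56 + 7 + 8. The constant terms are 3969 < 3976, the coefficients of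
   [x] are 126 < 127. *)
- move=> x; change ((28 + (35 + x)) ^ 2 < (56 + x) * (71 + x)); nia.
Qed.

(* The pieces 1 and 2 are triangular grids of 6 points; 12 > 10 = C(5,2). *)
Lemma not_log_concave_codim3 (k : fieldType) (v : nat) :
  infinite_field k -> ~ all_level_log_concave k 3 v.+3.
Proof.
move=> kinf; apply: (@rows_not_log_concave 0 2 0 v 2
  (plane_rows 0 [::] 0 3) (plane_rows 1 [::] 0 3 ++ plane_rows 2 [::] 0 3)
  (plane_rows 0 [::] 3 2) (degree_pairs 0 4)) => //.
- by case=> [|[|[|]]].
- by case=> [|[|]].
- by move=> b d bd; apply: mem_degree_pairs.
(* Here 18 = 6 + 12 and 27 = 18 + 4 + 5. The constant terms are 484 < 486, the coefficients of [x]
   are 44 < 45. *)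
- move=> x; change ((10 + (12 + x)) ^ 2 < (18 + x) * (27 + x)); nia.
Qed.

(** * The classification *)

Lemma all_level_log_concaveE (k : fieldType) (r t : nat) : infinite_field k ->
  0 < r -> 0 < t -> (r, t) <> (3, 2) ->
  all_level_log_concave k r t <-> (r <= 2 \/ (r = 3 /\ t = 1)).
Proof.
move=> kinf r0 t0 rt; split=> [lc|[r2|[-> ->]]]; last first.
- exact: log_concave_Gorenstein_codim3.
- exact: log_concave_codim_le2.
case: r r0 rt lc => [|[|[|[|r]]]] // _ rt lc; [by left | by left | right | ].
- by case: t t0 rt lc => [|[|[|t]]] // _ _ /not_log_concave_codim3.
- by case: t t0 rt lc => // t _ _ /not_log_concave_codim_ge4.
Qed.

Theorem theorem5 :
  (forall k : fieldType, infinite_field k ->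
     exists t0 : nat, (t0 = 1 \/ t0 = 2) /\
       forall r t : nat, 0 < r -> 0 < t ->
         (all_level_log_concave k r t <-> (r <= 2 \/ (r = 3 /\ t <= t0))))
  /\
  (forall k1 k2 : fieldType, infinite_field k1 -> infinite_field k2 ->
     forall r t : nat, 0 < r -> 0 < t -> (r, t) <> (3, 2) ->
       (all_level_log_concave k1 r t <-> all_level_log_concave k2 r t)).
Proof.
split=> [k kinf|k1 k2 k1inf k2inf r t r0 t0 rt]; last first.
  by rewrite !all_level_log_concaveE.
(* The undecided pair (3, 2) determines the choice of [t0] for [k]. *)
have [lc|nlc] := classic (all_level_log_concave k 3 2).
- exists 2; split=> [|r t r0 t0]; first by right.
  have [[-> ->]|rt] := classic ((r, t) = (3, 2)); first by split=> // _; right.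
  rewrite all_level_log_concaveE //; split=> -[|[rE tE]]; try by left.
    by right; rewrite tE.
  right; split=> //; case: t t0 tE rt => [|[|[|]]] // _ _ [].
  by rewrite rE.
- exists 1; split=> [|r t r0 t0]; first by left.
  have [[-> ->]|rt] := classic ((r, t) = (3, 2)); first by split=> // -[|[]].
  rewrite all_level_log_concaveE //; split=> -[|[-> tE]]; try by left.
    by right; rewrite tE.
  by right; split=> //; apply/eqP; rewrite eqn_leq tE.
Qed.
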